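(* Let $\alpha,\beta>0$ and, for $t\in(0,\infty)$, let $$H_{\alpha,\beta}(t)=\alpha e^{\beta/t}-\psi'(t)-\alpha.$$ For $\beta>0$ and $u\in(0,\infty)$ let $$G_{\beta}(u)=\frac{\beta u}{I_2\bigl(2\sqrt{\beta u}\,\bigr)}\,\frac{\mathrm{d}}{\mathrm{d}u}\biggl(\frac{u}{1-e^{-u}}\biggr).$$ Then: (1) if $(\alpha,\beta)=(1,1)$, the completely monotonic degree of $H_{1,1}(t)$ with respect to $t\in(0,\infty)$ is $4$; (2) if $\beta>1$, the completely monotonic degree of $H_{1/\beta,\beta}(t)$ with respect to $t\in(0,\infty)$ is $2$; (3) if $\alpha\beta>1$ and $\beta\ge1$, or if $\alpha\beta>1$, $0<\beta<1$, and $\alpha\beta^2\ge\max_{u\in(0,\infty)}G_\beta(u)$, the completely monotonic degree of $H_{\alpha,\beta}(t)$ with respect to $t\in(0,\infty)$ is $1$.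
   Context: Here $\Gamma$ is the Euler gamma function, $\psi=\Gamma'/\Gamma$ is the digamma function and $\psi'$ is the trigamma function. For $\nu\in\mathbb{R}$, $I_\nu$ is the modified Bessel function of the first kind, $I_\nu(z)=\sum_{k=0}^\infty\frac{1}{k!\,\Gamma(\nu+k+1)}\bigl(\frac z2\bigr)^{2k+\nu}$. A function $f$ is completely monotonic on $(0,\infty)$ if it is infinitely differentiable there and $(-1)^{n}f^{(n)}(x)\ge0$ for all integers $n\ge0$ and all $x\in(0,\infty)$. Completely monotonic degree: let $f$ be a completely monotonic function on $(0,\infty)$ and let $f(\infty)=\lim_{x\to\infty}f(x)$. If for some $r\in\mathbb{R}$ the function $x^r[f(x)-f(\infty)]$ is completely monotonic on $(0,\infty)$ but $x^{r+\varepsilon}[f(x)-f(\infty)]$ is not completely monotonic on $(0,\infty)$ for any $\varepsilon>0$, then $r$ is called the completely monotonic degree of $f(x)$ with respect to $x\in(0,\infty)$. If $x^r[f(x)-f(\infty)]$ is completely monotonic on $(0,\infty)$ for all $r\in\mathbb{R}$, the degree is said to be $\infty$. (In particular, saying that $f$ has a given degree includes that $f$ is completely monotonic on $(0,\infty)$.) *)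

(* Defs.v *)
From HB Require Import structures.
From mathcomp Require Import all_boot all_order all_algebra.
From mathcomp Require Import all_classical all_reals all_analysis.
Set Implicit Arguments.
Unset Strict Implicit.
Unset Printing Implicit Defensive.
Import Order.TTheory GRing.Theory Num.Theory.
Import numFieldNormedType.Exports.
Local Open Scope classical_set_scope.
Local Open Scope ring_scope.

Section SpecialFunctions.
Context {R : realType}.

(* Euler's integral of the second kind, convergent for x > 0. *)
Definition euler_integral (x : R) : R :=
  \int[lebesgue_measure]_(t in `]0, +oo[) (t `^ (x - 1) * expR (- t)).

(* For x <= 0 the integral is continued by the functional equation
   Gamma (x + n) = x (x + 1) ... (x + n - 1) Gamma x, with an n such that
   x + n > 0. At the poles 0, -1, -2, ... the product vanishes, and since
   0^-1 = 0 both Gamma and 1 / Gamma are 0 there; the latter is the usual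
   convention for the entire function 1 / Gamma. *)
Definition Gamma (x : R) : R :=
  if 0 < x then euler_integral x
  else let n := (Num.truncn (- x)).+1 in
       euler_integral (x + n%:R) / \prod_(0 <= i < n) (x + i%:R).

Definition digamma (x : R) : R := derive1 Gamma x / Gamma x.

Definition trigamma : R -> R := derive1 digamma.

Definition besselI (nu z : R) : R :=
  limn (series (fun k : nat =>
    (k`!%:R * Gamma (nu + k%:R + 1))^-1 * (z / 2) `^ ((2 * k)%:R + nu))).

End SpecialFunctions.

Section CompletelyMonotonic.
Context {R : realType}.

(* The functions are total on R, but only their values on ]0, +oo[ matter,
   since derivatives are local and ]0, +oo[ is open. The derivability clause is
   needed because derive1n is total. *)
Definition completely_monotonic (f : R -> R) : Prop :=
  forall (n : nat) (x : R), 0 < x ->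
    derivable (derive1n n f) x 1 /\ 0 <= (-1) ^+ n * derive1n n f x.

Definition has_cm_degree (f : R -> R) (r : R) : Prop :=
  let f_infty := lim (f x @[x --> +oo]) in
  [/\ completely_monotonic f,
      completely_monotonic (fun x => x `^ r * (f x - f_infty)) &
      forall eps : R, 0 < eps ->
        ~ completely_monotonic (fun x => x `^ (r + eps) * (f x - f_infty))].

Definition is_maximum_on (D : set R) (g : R -> R) (M : R) : Prop :=
  (g @` D) M /\ ubound (g @` D) M.

End CompletelyMonotonic.

Section Families.
Context {R : realType}.

Definition H (alpha beta t : R) : R :=
  alpha * expR (beta / t) - trigamma t - alpha.

Definition G (beta u : R) : R :=
  beta * u / besselI 2 (2 * Num.sqrt (beta * u)) *
  derive1 (fun v : R => v / (1 - expR (- v))) u.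

End Families.

(* Main.v *)
Require Import Defs.
From Stdlib Require Import ZArith.
From mathcomp Require Import all_boot all_order all_algebra.
From mathcomp Require Import all_classical all_reals all_analysis.
From mathcomp Require Import measurable_realfun lebesgue_integral_differentiation ring lra ssrZ.
Set Implicit Arguments.
Unset Strict Implicit.
Unset Printing Implicit Defensive.
Import Order.TTheory GRing.Theory Num.Theory.
Import numFieldNormedType.Exports.
Local Open Scope classical_set_scope.
Local Open Scope ring_scope.

(* Write F(u) = u / (1 - e^-u) and B_k for the k-th derivative of the Bessel
   series sum_n u^n / (n! (n+1)!). On ]0, +oo[, the function H alpha beta is the
   Laplace transform of h(u) = alpha beta B_0(beta u) - F(u); multiplying a
   Laplace transform by t differentiates its density and adds the value at 0, so
   t^(r+1) H = h^(r)(0) + L[h^(r+1)] as soon as h, ..., h^(r-1) vanish at 0.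
   Hence t^(r+1) H is completely monotonic once h^(r+1) >= 0, and the exponent
   cannot be raised, since t^(r+1) H >= h^(r)(0) > 0 while completely monotonic
   functions are nonincreasing. For alpha = beta = 1 and r = 3 the positivity of
   h'''' follows from F''''(u) <= 1/120 + u/720, which after clearing
   denominators is the positivity of an exponential polynomial; integrating it
   back settles every case with beta >= 1, and in the last case h' >= 0 is
   exactly alpha beta^2 >= G.
   That trigamma is L[F] is shown without infinite series: both solve
   f(t) - f(t+1) = 1/t^2, trigamma is nonnegative because Gamma is log-convex,
   and the increments of digamma over unit intervals tend to 0. *)

(** * Exponential families *)

(** The exponents 4, 2 and 1 are read off Taylor coefficients at 0. Since F(u) = 1 + u/2 + u^2/12 +
    O(u^4) and B_k(0) = 1/(k+1)!, the values of h, h', h'', h''' at 0 are alpha beta - 1, (alpha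
    beta^2 - 1)/2, (alpha beta^3 - 1)/6 and alpha beta^4/24. The number r is the index of the first
    nonzero one: 3 for alpha = beta = 1, 1 for alpha beta = 1 < beta, 0 for alpha beta > 1. These
    values are needed exactly where the formula u / (1 - e^-u) breaks down. Therefore F is treated
    as the reciprocal of the entire series of (1 - e^-u) / u, and the closed form in e^u is used
    only for u > 0. Gamma (as a function of x, with ln u in the exponent) and Laplace transforms (as
    functions of t, with -u in the exponent) are both integrals of e^(x a(u)) w(u), so
    differentiation under the integral sign is done once for such families. Integrals of nonnegative
    functions are compared in the extended reals: each integration by parts then yields the
    finiteness of one side from that of the other. *)

Lemma exprn_le_fact_expR (R : realType) (j : nat) (y : R) :
  0 <= y -> y ^+ j <= j`!%:R * expR y.
Proof.
move=> y0; case: j => [|j].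
  by rewrite expr0 fact0 mul1r -[leLHS]expR0 ler_expR.
rewrite mulrC -ler_pdivrMr ?ltr0n ?fact_gt0//.
by apply: le_trans (expR_ge1Dxn j y0); rewrite lerDr.
Qed.

(** The power is absorbed by e^(c |y|), which only moves the exponent from x to x + c or x - c. Both
    stay in [c, x0], where e^(z y) is at most the sum of its values at the two ends, whatever the
    sign of y. The bound does not depend on x and serves as the dominating function for
    differentiation under the integral. *)
Lemma normrX_expR_le (R : realType) (j : nat) (c x0 y x : R) : 0 < c ->
  c <= x - c -> x + c <= x0 ->
  `|y| ^+ j * expR (x * y) <=
    2 * (j`!%:R * c ^- j) * (expR (c * y) + expR (x0 * y)).
Proof.
move=> c0 h1 h2.
have le1 z : c <= z -> z <= x0 -> expR (z * y) <= expR (c * y) + expR (x0 * y).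
  move=> cz zx; case: (lerP 0 y) => y0.
    rewrite (@le_trans _ _ (expR (x0 * y)))// ?lerDr ?expR_ge0//.
    by rewrite ler_expR ler_wpM2r.
  rewrite (@le_trans _ _ (expR (c * y)))// ?lerDl ?expR_ge0//.
  by rewrite ler_expR ler_wnM2r// ltW.
have -> : `|y| ^+ j = c ^- j * (c * `|y|) ^+ j.
  by rewrite exprMn mulrA mulVf ?mul1r// expf_neq0// gt_eqF.
have := @exprn_le_fact_expR R j (c * `|y|).
rewrite mulr_ge0 ?(ltW c0)// => /(_ isT) h.
have e2 : expR (c * `|y|) * expR (x * y) <= 2 * (expR (c * y) + expR (x0 * y)).
  rewrite -expRD.
  have le2 z : c <= z -> z <= x0 -> expR (z * y) <= 2 * (expR (c * y) + expR (x0 * y)).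
    move=> cz zx; have := le1 z cz zx; have := expR_ge0 (z * y).
    by set p := expR _ + _; lra.
  case: (lerP 0 y) => y0.
    by rewrite (ger0_norm y0) -mulrDl [c + x]addrC; apply: le2; lra.
  by rewrite (ltr0_norm y0) mulrN -mulNr -mulrDl [- c + x]addrC; apply: le2; lra.
rewrite (@le_trans _ _ (c ^- j * (j`!%:R * expR (c * `|y|)) * expR (x * y)))//.
  rewrite ler_wpM2r ?expR_ge0// ler_wpM2l// invr_ge0 exprn_ge0// ltW//.
have k0 : 0 <= j`!%:R * c ^- j by rewrite mulr_ge0// invr_ge0 exprn_ge0// ltW.
rewrite [leLHS](_ : _ = j`!%:R * c ^- j * (expR (c * `|y|) * expR (x * y))); last by ring.
rewrite [leRHS](_ : _ = j`!%:R * c ^- j * (2 * (expR (c * y) + expR (x0 * y)))); last by ring.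
exact: ler_wpM2l.
Qed.

Section exponential_family.
Context {R : realType} {d : measure_display} {T : measurableType d}.
Variables (mu : {measure set T -> \bar R}) (D : set T) (a w : T -> R).
Hypotheses (mD : measurable D) (ma : measurable_fun D a)
  (mw : measurable_fun D w) (w0 : forall u, D u -> 0 <= w u).
Hypothesis fin : forall x : R, 0 < x ->
  (\int[mu]_(u in D) (expR (x * a u) * w u)%:E < +oo)%E.

(** The j-th derivative in x of the integral of e^(x a(u)) w(u). It is used with [a] equal to [ln]
    for Gamma and with [a] equal to [-%R] for Laplace transforms. *)
Definition moment (j : nat) (x : R) : R :=
  \int[mu]_(u in D) (a u ^+ j * expR (x * a u) * w u).

Lemma measurable_moment j x :
  measurable_fun D (fun u => a u ^+ j * expR (x * a u) * w u).
Proof.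
apply: measurable_funM => //; apply: measurable_funM.
  exact: measurable_funX.
apply: measurableT_comp => //.
exact: measurable_funM.
Qed.

Lemma integrable_expR_family (x : R) : 0 < x ->
  mu.-integrable D (EFin \o (fun u => expR (x * a u) * w u)).
Proof.
move=> x0; apply/integrableP; split.
  apply/measurable_EFinP; have := @measurable_moment 0%N x.
  by under eq_fun do rewrite expr0 mul1r.
rewrite (le_lt_trans _ (fin x0))// le_eqVlt; apply/orP; left; apply/eqP.
apply: eq_integral => u /set_mem Du /=.
by rewrite ger0_norm// mulr_ge0 ?expR_ge0// w0.
Qed.

Lemma integrable_moment_bound (c x0 C : R) : 0 < c -> 0 < x0 ->
  mu.-integrable D (EFin \o (fun u => C * (expR (c * a u) + expR (x0 * a u)) * w u)).
Proof.
move=> c0 x00.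
have -> : (EFin \o (fun u => C * (expR (c * a u) + expR (x0 * a u)) * w u)) =
  (fun u => C%:E * ((EFin \o (fun u => (expR (c * a u) * w u)%R)) \+
    (EFin \o (fun u => (expR (x0 * a u) * w u)%R))) u)%E.
  by apply/funext => u /=; rewrite -EFinD -EFinM; congr EFin; ring.
by apply: integrableZl => //; apply: integrableD => //; exact: integrable_expR_family.
Qed.

Lemma integrable_moment j (x : R) : 0 < x ->
  mu.-integrable D (EFin \o (fun u => a u ^+ j * expR (x * a u) * w u)).
Proof.
move=> x0.
pose c := x / 2.
have c0 : 0 < c by rewrite divr_gt0.
have y0 : 0 < x + c by rewrite addr_gt0.
apply: le_integrable (integrable_moment_bound (2 * (j`!%:R * c ^- j)) c0 y0) => //.
  by apply/measurable_EFinP; exact: measurable_moment.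
move=> u Du /=; rewrite lee_fin normrM (ger0_norm (w0 Du)) [leRHS]normrM (ger0_norm (w0 Du)).
rewrite ler_wpM2r ?w0// normrM (ger0_norm (expR_ge0 _)) normrX.
apply: le_trans (ler_norm _).
by apply: normrX_expR_le; rewrite // /c; lra.
Qed.

Lemma is_derive_moment (j : nat) (x : R) : 0 < x ->
  is_derive x (1 : R) (moment j) (moment j.+1 x).
Proof.
move=> x0.
pose f x u := a u ^+ j * expR (x * a u) * w u.
have df (y : R) u : is_derive y (1:R) (f ^~ u) (a u ^+ j.+1 * expR (y * a u) * w u).
  rewrite /f; apply: is_derive_eq.
  by rewrite /GRing.scale /= exprS !mulr0 mulr1 !add0r; ring.
have E (y : R) u : partial1of2 f y u = a u ^+ j.+1 * expR (y * a u) * w u.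
  by rewrite partial1of2E; apply: derive_val.
(* For every y in ]lo, hi[ these choices give c <= y - c and y + c <= y0, as [normrX_expR_le]
   demands. *)
pose lo := x / 2; pose hi := 3 / 2 * x; pose c := x / 4; pose y0 := 2 * x.
pose G u := `|2 * (j.+1`!%:R * c ^- j.+1) * (expR (c * a u) + expR (y0 * a u)) * w u|.
have Ix : `]lo, hi[%classic x by rewrite /= in_itv/= /lo /hi; apply/andP; split; lra.
have intf y : `]lo, hi[%classic y -> mu.-integrable D (EFin \o f y).
  rewrite /= in_itv/= => /andP[ly _]; apply: integrable_moment.
  by rewrite (lt_trans _ ly)// /lo; lra.
have derf y u : `]lo, hi[%classic y -> D u -> derivable (f ^~ u) y 1 by move=> _ _; exact: ex_derive.
have G0 u : 0 <= G u by exact: normr_ge0.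
have c0 : 0 < c by rewrite divr_gt0.
have y00 : 0 < y0 by rewrite mulr_gt0.
have intG : mu.-integrable D (EFin \o G).
  have := integrable_abse (integrable_moment_bound (2 * (j.+1`!%:R * c ^- j.+1)) c0 y00).
  by [].
have ub y u : `]lo, hi[%classic y -> D u -> `|partial1of2 f y u| <= G u.
  rewrite /= in_itv/= => /andP[ly yh] Du; rewrite E /G.
  rewrite normrM (ger0_norm (w0 Du)) [leRHS]normrM (ger0_norm (w0 Du)).
  rewrite ler_wpM2r ?w0// normrM (ger0_norm (expR_ge0 _)) normrX.
  apply: le_trans (ler_norm _).
  by apply: normrX_expR_le; rewrite /lo /hi in ly yh; rewrite // /c /y0; lra.
have dd := derivable_under_integral mD Ix intf derf G0 intG ub.
have dv := differentiation_under_integral mD Ix intf derf G0 intG ub.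
apply: DeriveDef => //.
rewrite -derive1E.
rewrite /moment /= in dv *.
rewrite dv.
by apply: eq_Rintegral => u _; rewrite E.
Qed.

End exponential_family.

(** * Laplace transforms *)

(** The fundamental theorem of calculus on the segments [1/(n+2), n+2], followed by monotone
    convergence for p and q separately. As an identity of extended reals it also transfers
    finiteness between the two integrals. *)
Lemma ge0_integration_by_parts_0y (R : realType) (p q W : R -> R) (W0 l : R) :
  (forall u, 0 < u -> 0 <= p u) -> (forall u, 0 < u -> 0 <= q u) ->
  {in `]0, +oo[, continuous p} -> {in `]0, +oo[, continuous q} ->
  (forall u : R, 0 < u -> is_derive u 1 W (p u - q u)) ->
  W x @[x --> 0^'+] --> W0 -> W x @[x --> +oo] --> l ->
  (\int[lebesgue_measure]_(u in `]0%R, +oo[) (p u)%:E =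
   \int[lebesgue_measure]_(u in `]0%R, +oo[) (q u)%:E + (l - W0)%:E)%E.
Proof.
move=> p0 q0 cp cq dW W0P lP.
pose a n : R := n.+2%:R^-1; pose b n : R := n.+2%:R.
have a0 n : 0 < a n by rewrite invr_gt0.
have ab n : a n < b n.
  by rewrite (@lt_le_trans _ _ 1)// ?invf_lt1 ?ltr1n ?ler1n.
pose S n := `[a n, b n]%classic.
have S0 n u : S n u -> 0 < u.
  by rewrite /S /= in_itv/= => /andP[au _]; exact: lt_le_trans au.
have SU : \bigcup_n S n = `]0, +oo[%classic.
  apply/seteqP; split=> [u [n _ /S0]|u]; rewrite /= in_itv/= ?andbT// => u0.
  pose m := (Num.truncn (u + u^-1)).
  have hm : u + u^-1 < m.+1%:R by exact: truncnS_gt.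
  have iu0 : 0 < u^-1 by rewrite invr_gt0.
  have hm2 : m.+1%:R <= m.+2%:R :> R by rewrite ler_nat.
  exists m => //; rewrite /S /= in_itv/= /a /b; apply/andP; split; last by lra.
  by rewrite -[leRHS]invrK lef_pV2 ?posrE ?ltr0n//; lra.
have SS : {homo S : n m / (n <= m)%N >-> (n <= m)%O}.
  move=> n m nm; rewrite subsetEset; apply: subset_itv; rewrite bnd_simp.
    by rewrite /a lef_pV2 ?posrE ?ltr0n// ler_nat.
  by rewrite /b ler_nat.
have mS n : measurable (S n : set (measurableTypeR R)) by exact: measurable_itv.
have cS (f : R -> R) n : {in `]0, +oo[, continuous f} -> {within S n, continuous f}.
  move=> cf; apply: continuous_in_subspaceT => x /set_mem /S0 x0.
  by apply: cf; rewrite in_itv/= x0.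
have iS (f : R -> R) n : {in `]0, +oo[, continuous f} ->
    lebesgue_measure.-integrable (S n) (EFin \o f).
  by move=> cf; apply: continuous_compact_integrable; [exact: segment_compact|exact: cS].
have key n : (\int[lebesgue_measure]_(u in S n) (p u)%:E =
    \int[lebesgue_measure]_(u in S n) (q u)%:E + (W (b n) - W (a n))%:E)%E.
  have cW x : 0 < x -> {for x, continuous W}.
    move=> x0; apply: differentiable_continuous; apply/derivable1_diffP.
    by have [] := dW _ x0.
  have F2 := @continuous_FTC2 R (fun u => p u - q u) W _ _ (ab n).
  have := integralB_EFin (mS n) (iS _ n cp) (iS _ n cq).
  rewrite -/(S n).
  under eq_integral do rewrite -EFinB.
  rewrite F2; last first.
  - move=> x; rewrite in_itv/= => /andP[ax _].
    by have [_] := dW _ (lt_trans (a0 n) ax); rewrite derive1E.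
  - split.
    + move=> x; rewrite in_itv/= => /andP[ax _].
      by have [] := dW _ (lt_trans (a0 n) ax).
    + by apply: cvg_at_right_filter; apply: cW.
    + by apply: cvg_at_left_filter; apply: cW; rewrite /b ltr0n.
  - apply: continuous_in_subspaceT => x /set_mem /S0 x0.
    by apply: cvgB; [apply: cp|apply: cq]; rewrite in_itv/= x0.
  have fp := integrable_fin_num (mS n) (iS _ n cp).
  have fq := integrable_fin_num (mS n) (iS _ n cq).
  rewrite /comp /= -/(S n) in fp fq.
  rewrite -(fineK fp) -(fineK fq) -!EFinB => -[E].
  by rewrite -EFinD E; congr EFin; ring.
have cvgI (f : R -> R) : (forall u, 0 < u -> 0 <= f u) -> {in `]0, +oo[, continuous f} ->
    (\int[lebesgue_measure]_(u in S n) (f u)%:E)%E @[n --> \oo] -->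
    (\int[lebesgue_measure]_(u in `]0%R, +oo[) (f u)%:E)%E.
  move=> f0 cf; rewrite -SU; apply: ge0_nondecreasing_set_cvg_integral => //.
  - move=> n; apply/measurable_EFinP.
    have mf : measurable_fun (`]0, +oo[%classic : set (measurableTypeR R)) f.
      apply: open_continuous_measurable_fun => //.
      by move=> x /set_mem; exact: cf.
    apply: measurable_funS mf => //.
    by move=> u /S0 u0; rewrite /= in_itv/= u0.
  - by move=> n u /S0 u0; rewrite lee_fin f0.
have L1 := cvgI _ p0 cp.
have b_oo : b n @[n --> \oo] --> +oo.
  have := @cvgr_idn R; rewrite -(cvg_shiftn 2).
  by under eq_fun do rewrite addn2.
have Wb : (W (b n)) @[n --> \oo] --> l by move/cvg_pinftyP : lP; apply.
have Wa : (W (a n)) @[n --> \oo] --> W0.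
  move/cvg_at_rightP : W0P; apply; split => //.
  have := @cvg_harmonic R; rewrite -(cvg_shiftn 1).
  by under eq_fun do rewrite /harmonic/= addn1.
have L2 : ((\int[lebesgue_measure]_(u in S n) (q u)%:E + (W (b n) - W (a n))%:E)%E @[n --> \oo] -->
    (\int[lebesgue_measure]_(u in `]0%R, +oo[) (q u)%:E + (l - W0)%:E)%E).
  apply: cvgeD; [by rewrite fin_num_adde_defl|exact: cvgI|].
  by apply: cvg_EFin; [exact: nearW|apply: cvgB].
move: L2; under eq_fun do rewrite -key.
exact: cvg_unique L1.
Qed.

Section laplace.
Context {R : realType}.
Implicit Types (f df : R -> R) (t : R).

(** The exponent is written [t * - u] so that Laplace transforms are instances of [moment]. *)
Definition laplace_finite f := forall t : R, 0 < t ->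
  (\int[lebesgue_measure]_(u in `]0%R, +oo[) (expR (t * - u) * f u)%:E < +oo)%E.

Definition laplace f t : R :=
  \int[lebesgue_measure]_(u in `]0%R, +oo[) (expR (t * - u) * f u).

Local Notation mu := (@lebesgue_measure R).
Local Notation D := (`]0%R, +oo[%classic : set (measurableTypeR R)).

Lemma continuous_measurable_0y f : {in `]0, +oo[, continuous f} ->
  measurable_fun D f.
Proof.
move=> cf; apply: open_continuous_measurable_fun => //.
by move=> x /set_mem; exact: cf.
Qed.

Lemma laplace_moment f t : laplace f t = moment mu D -%R f 0 t.
Proof. by rewrite /laplace /moment; under [in RHS]eq_Rintegral do rewrite expr0 mul1r. Qed.

Lemma is_derive_laplace_moment f j t :
  {in `]0, +oo[, continuous f} -> (forall u : R, 0 < u -> 0 <= f u) ->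
  laplace_finite f -> 0 < t ->
  is_derive t (1 : R) (moment mu D -%R f j) (moment mu D -%R f j.+1 t).
Proof.
move=> cf f0 ff; apply: is_derive_moment => //.
- exact: continuous_measurable_0y.
- by move=> u; rewrite /= in_itv/= andbT; exact: f0.
Qed.

Lemma laplace_ge0 f t : (forall u : R, 0 < u -> 0 <= f u) -> 0 <= laplace f t.
Proof.
move=> f0; apply: Rintegral_ge0 => u; rewrite /= in_itv/= andbT => u0.
by rewrite mulr_ge0 ?expR_ge0// f0.
Qed.

(** The iterated derivatives of a total function are known only on the half-line. There they are
    identified with [g n] by induction, since a derivative depends only on values near the point. *)
Lemma completely_monotonic_seq (f : R -> R) (g : nat -> R -> R) :
  (forall x : R, 0 < x -> f x = g 0%N x) ->
  (forall n (x : R), 0 < x -> is_derive x (1 : R) (g n) (g n.+1 x)) ->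
  (forall n (x : R), 0 < x -> 0 <= (-1) ^+ n * g n x) ->
  completely_monotonic f.
Proof.
move=> fg dg g0.
have near_pos (x : R) (P : R -> Prop) : 0 < x -> (forall y, 0 < y -> P y) ->
    \forall y \near x, P y.
  move=> x0 HP; near=> y; apply: HP; near: y; exact: lt_nbhsr.
have E n (x : R) : 0 < x -> derive1n n f x = g n x.
  elim: n x => [|n IH] x x0; first exact: fg.
  rewrite derive1nS derive1E.
  rewrite (@near_eq_derive _ _ _ _ (g n)) ?oner_eq0//; last exact: near_pos.
  by have [_ ->] := dg n x x0.
move=> n x x0; split; last by rewrite E// g0.
apply: (@near_eq_derivable _ _ _ (g n)); rewrite ?oner_eq0//.
  by apply: near_pos => // y y0; rewrite E.
by have [] := dg n x x0.
Unshelve. all: by end_near. Qed.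

(** The easy half of Bernstein's theorem: each derivative brings down a factor -u, and the signs
    cancel. The constant c stands for a point mass at 0. *)
Lemma completely_monotonic_laplace (h f : R -> R) (c : R) :
  {in `]0, +oo[, continuous f} -> (forall u : R, 0 < u -> 0 <= f u) ->
  laplace_finite f -> 0 <= c ->
  (forall t : R, 0 < t -> h t = c + laplace f t) ->
  completely_monotonic h.
Proof.
move=> cf f0 ff c0 hE.
pose g n t := (if n == 0%N then c else 0) + moment mu D -%R f n t.
apply: (@completely_monotonic_seq h g).
- by move=> x x0; rewrite hE// laplace_moment.
- move=> n x x0; have dm := is_derive_laplace_moment n cf f0 ff x0.
  rewrite /g; apply: is_derive_eq.
  by rewrite /= !add0r mul1r.
- move=> n x x0; rewrite /g mulrDr addr_ge0//.
    by case: n => [|n] /=; rewrite ?expr0 ?mul1r ?mulr0.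
  have -> : (-1) ^+ n * moment mu D -%R f n x =
      \int[mu]_(u in D) (u ^+ n * expR (x * - u) * f u).
    rewrite /moment -RintegralZl//; last first.
      apply: integrable_moment => //; first exact: continuous_measurable_0y.
      by move=> u; rewrite /= in_itv/= andbT; exact: f0.
    apply: eq_Rintegral => u _; rewrite !mulrA; congr (_ * _ * _).
    by rewrite -exprMn mulN1r opprK.
  apply: Rintegral_ge0 => u; rewrite /= in_itv/= andbT => u0.
  by rewrite !mulr_ge0 ?expR_ge0 ?exprn_ge0 ?f0// ltW.
Qed.

End laplace.

Lemma ge0_derive_nondecreasing (R : realType) (f df : R -> R) :
  (forall u : R, 0 <= u -> is_derive u (1 : R) f (df u)) ->
  (forall u : R, 0 < u -> 0 <= df u) ->
  forall x y : R, 0 <= x -> x <= y -> f x <= f y.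
Proof.
move=> dd df0 x y x0 xy; have [->//|xny] := eqVneq x y.
have {xny}xy : x < y by rewrite lt_neqAle xny.
have [||c cxy E] := @MVT R f df x y xy.
- by move=> z; rewrite in_itv/= => /andP[xz _]; apply: dd; apply: le_trans x0 (ltW xz).
- apply: continuous_in_subspaceT => z /set_mem /=; rewrite in_itv/= => /andP[xz _].
  apply: differentiable_continuous; apply/derivable1_diffP.
  by have [] := dd _ (le_trans x0 xz).
move: cxy; rewrite in_itv/= => /andP[xc _].
by rewrite -subr_ge0 E mulr_ge0 ?subr_ge0 ?(ltW xy)// df0// (le_lt_trans x0 xc).
Qed.

(** * Laplace transform of a derivative *)

Section laplace_derivative.
Context {R : realType}.
Implicit Types (f df : R -> R) (t : R).
Local Notation mu := (@lebesgue_measure R).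
Local Notation D := (`]0%R, +oo[%classic : set (measurableTypeR R)).

Lemma laplaceE f t : (forall u : R, 0 < u -> 0 <= f u) -> laplace_finite f -> 0 < t ->
  (\int[mu]_(u in D) (expR (t * - u) * f u)%:E = (laplace f t)%:E)%E.
Proof.
move=> f0 ff t0; rewrite /laplace /Rintegral fineK// ge0_fin_numE ?ff//.
apply: integral_ge0 => u; rewrite /= in_itv/= andbT => u0.
by rewrite lee_fin mulr_ge0 ?expR_ge0// f0.
Qed.

Lemma laplace_finite_le f (g : R -> R) : {in `]0, +oo[, continuous f} -> {in `]0, +oo[, continuous g} ->
  (forall u : R, 0 < u -> 0 <= f u) ->
  (forall u : R, 0 < u -> f u <= g u) -> laplace_finite g -> laplace_finite f.
Proof.
move=> cf cg f0 fg fing t t0; apply: le_lt_trans (fing t t0).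
have me (h : R -> R) : {in `]0, +oo[, continuous h} ->
    measurable_fun D (fun u => (expR (t * - u) * h u)%:E).
  move=> ch; apply/measurable_EFinP/measurable_funM; last exact: continuous_measurable_0y.
  by apply: measurableT_comp => //; exact: measurable_funM.
apply: ge0_le_integral => //.
- move=> u; rewrite /= in_itv/= andbT => u0.
  by rewrite lee_fin mulr_ge0 ?expR_ge0// f0.
- exact: me.
- exact: me.
- move=> u; rewrite /= in_itv/= andbT => u0.
  by rewrite lee_fin ler_wpM2l ?expR_ge0// fg.
Qed.

Lemma integral_0y_ge (g : R -> R) (u c : R) :
  {in `]0, +oo[, continuous g} -> (forall v : R, 0 < v -> 0 <= g v) ->
  0 < u -> 0 <= c -> (forall v : R, u <= v -> v <= u + 1 -> c <= g v) ->
  (c%:E <= \int[mu]_(v in D) (g v)%:E)%E.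
Proof.
move=> cg g0 u0 c0 cleg.
pose I : set (measurableTypeR R) := `[u, u + 1]%classic.
have mI : measurable I by exact: measurable_itv.
have ID : I `<=` D.
  move=> v; rewrite /I /= !in_itv/= andbT => /andP[uv _]; exact: lt_le_trans uv.
have me : measurable_fun D (fun v => (g v)%:E).
  by apply/measurable_EFinP; exact: continuous_measurable_0y.
have e0 v : D v -> (0 <= (g v)%:E)%E.
  by rewrite /= in_itv/= andbT => v0; rewrite lee_fin g0.
apply: (@le_trans _ _ (\int[mu]_(v in I) (g v)%:E)%E); last first.
  by apply: ge0_subset_integral => //; exact: measurable_itv.
have -> : c%:E = (\int[mu]_(v in I) (cst c%:E v))%E.
  rewrite integral_cst// /I /= lebesgue_measure_itv/= lte_fin ltrDl ltr01.
  by rewrite -EFinB addrAC subrr add0r mule1.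
apply: ge0_le_integral => //.
- exact: measurable_funS me.
- move=> v; rewrite /I /= in_itv/= => /andP[uv v1].
  by rewrite lee_fin cleg.
Qed.

(** The integrand is at least the left-hand side on [u, u + 1]. Thus a finite transform at every t >
    0 forces f to grow more slowly than any exponential, which removes the boundary term at infinity
    in [laplace_derivative]. *)
Lemma nondecreasing_laplace_bound f t :
  {in `]0, +oo[, continuous f} ->
  (forall u : R, 0 < u -> 0 <= f u) -> {in `]0, +oo[ &, {homo f : x y / x <= y}} ->
  laplace_finite f -> 0 < t ->
  forall u : R, 0 < u -> expR (- t * (u + 1)) * f u <= laplace f t.
Proof.
move=> cf f0 ndf ff t0 u u0.
rewrite -lee_fin -laplaceE//; apply: (@integral_0y_ge _ u) => //.
- move=> v v0; apply: cvgM; last exact: cf.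
  apply: continuous_comp; last exact: continuous_expR.
  by apply: continuousM; [exact: cst_continuous|exact: continuousN].
- by move=> v v0; rewrite mulr_ge0 ?expR_ge0// f0.
- by rewrite mulr_ge0 ?expR_ge0// f0.
- move=> v uv v1; have v0 : 0 < v by exact: lt_le_trans uv.
  rewrite ler_pM ?expR_ge0 ?f0//.
    by rewrite ler_expR mulrN mulNr lerN2 ler_wpM2l// ltW.
  by apply: ndf; rewrite ?in_itv/= ?andbT.
Qed.

Lemma laplace_derivative f df t :
  (forall u : R, 0 <= u -> is_derive u (1 : R) f (df u)) ->
  {in `]0, +oo[, continuous df} ->
  (forall u : R, 0 < u -> 0 <= df u) -> 0 <= f 0 ->
  laplace_finite f -> 0 < t ->
  (\int[mu]_(u in D) (expR (t * - u) * df u)%:E = (t * laplace f t - f 0)%:E)%E.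
Proof.
move=> dd cdf df0 f00 ff t0.
have cf (u : R) : 0 <= u -> {for u, continuous f}.
  move=> u0; apply: differentiable_continuous; apply/derivable1_diffP.
  by have [] := dd _ u0.
have ndf := ge0_derive_nondecreasing dd df0.
have f0 (u : R) : 0 <= u -> 0 <= f u by move=> u0; apply: le_trans f00 _; exact: ndf.
have cf' : {in `]0, +oo[, continuous f}.
  by move=> u; rewrite in_itv/= andbT => /ltW; exact: cf.
have f0' (u : R) : 0 < u -> 0 <= f u by move=> /ltW; exact: f0.
have ce (k : R) : continuous (fun u : R => expR (k * - u)).
  move=> u; apply: continuous_comp; last exact: continuous_expR.
  by apply: continuousM; [exact: cst_continuous|exact: continuousN].
have L : expR (t * - x) * f x @[x --> +oo] --> (0 : R).
  (* The growth bound is applied at t/2, so that a decaying factor e^(-t x/2) is left over. *)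
  pose s := t / 2; have s0 : 0 < s by rewrite divr_gt0.
  have B : \forall x \near +oo, 0 <= expR (t * - x) * f x <=
      laplace f s * expR s * expR (- (s * x)).
    near=> x.
    have x0 : 0 < x by near: x; exact: nbhs_pinfty_gt.
    rewrite mulr_ge0 ?expR_ge0 ?f0'//=.
    have ndf' : {in `]0, +oo[ &, {homo f : x y / x <= y}}.
      by move=> y z; rewrite in_itv/= andbT => y0 _; apply: ndf; exact: ltW.
    have := @nondecreasing_laplace_bound f s cf' f0' ndf' ff s0 x x0.
    have -> : expR (t * - x) * f x =
        expR (- s * (x + 1)) * f x * (expR s * expR (- (s * x))).
      rewrite -expRD mulrAC -expRD; congr (expR _ * _); rewrite /s; by field.
    move=> h; rewrite -[leRHS]mulrA.
    by apply: ler_wpM2r; rewrite ?mulr_ge0 ?expR_ge0.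
  apply: (@squeeze_cvgr _ _ _ _ (cst 0) _ _ B 0 (cvg_cst _)).
  rewrite -(mulr0 (laplace f s * expR s)); apply: cvgMl_tmp.
  apply: (@cvg_comp _ _ _ (fun x : R => s * x) (fun x => expR (- x))); last exact: cvgr_expR.
  by apply: gt0_cvgMry.
have W0 : expR (t * - x) * f x @[x --> 0^'+] --> expR (t * - 0) * f 0.
  by apply: cvg_at_right_filter; apply: cvgM; [exact: ce|apply: cf].
pose p u := expR (t * - u) * df u.
pose q u := t * (expR (t * - u) * f u).
have p0 (u : R) : 0 < u -> 0 <= p u by move=> u0; rewrite mulr_ge0 ?expR_ge0// df0.
have q0 (u : R) : 0 < u -> 0 <= q u.
  by move=> u0; rewrite !mulr_ge0 ?expR_ge0 ?(ltW t0)// f0'.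
have cp : {in `]0, +oo[, continuous p}.
  by move=> u u0; apply: cvgM; [exact: ce|exact: cdf].
have cq : {in `]0, +oo[, continuous q}.
  by move=> u u0; apply: cvgM; [exact: cvg_cst|apply: cvgM; [exact: ce|exact: cf']].
have dW (u : R) : 0 < u -> is_derive u (1 : R) (fun u => expR (t * - u) * f u) (p u - q u).
  move=> u0; have ? := dd _ (ltW u0).
  apply: is_derive_eq.
  by rewrite /GRing.scale /= /p /q; ring.
rewrite (ge0_integration_by_parts_0y p0 q0 cp cq dW W0 L).
rewrite oppr0 mulr0 expR0 mul1r sub0r /q.
rewrite (_ : (\int[mu]_(u in D) _)%E = (t * laplace f t)%:E) ?EFinD//.
under eq_integral do rewrite EFinM.
rewrite ge0_integralZl_EFin ?(ltW t0)//.
- by rewrite laplaceE.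
- move=> u; rewrite /= in_itv/= andbT => u0.
  by rewrite lee_fin mulr_ge0 ?expR_ge0// f0'.
- apply/measurable_EFinP/measurable_funM; last exact: continuous_measurable_0y.
  by apply: measurableT_comp => //; exact: measurable_funM.
Unshelve. all: by end_near. Qed.

End laplace_derivative.

Lemma derive_nonincreasing (R : realType) (f df : R -> R) :
  (forall u : R, 0 < u -> is_derive u (1 : R) f (df u)) ->
  (forall u : R, 0 < u -> df u <= 0) ->
  forall x y : R, 0 < x -> x <= y -> f y <= f x.
Proof.
move=> dd df0 x y x0 xy; have [->//|xny] := eqVneq x y.
have {xny}xy : x < y by rewrite lt_neqAle xny.
have [||c cxy E] := @MVT R f df x y xy.
- by move=> z; rewrite in_itv/= => /andP[xz _]; apply: dd; exact: lt_trans xz.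
- apply: continuous_in_subspaceT => z /set_mem /=; rewrite in_itv/= => /andP[xz _].
  apply: differentiable_continuous; apply/derivable1_diffP.
  by have [] := dd _ (lt_le_trans x0 xz).
move: cxy; rewrite in_itv/= => /andP[xc _].
by rewrite -subr_le0 E mulr_le0_ge0 ?subr_ge0 ?(ltW xy)// df0// (lt_trans x0 xc).
Qed.

(** * Completely monotonic degree of a Laplace transform *)

Section degree.
Context {R : realType}.
Variables (f : nat -> R -> R) (r : nat) (c : R) (h : R -> R).
Hypotheses
  (df : forall k (u : R), (k <= r)%N -> 0 <= u -> is_derive u (1 : R) (f k) (f k.+1 u))
  (cr : {in `]0, +oo[, continuous (f r.+1)})
  (fr0 : forall u : R, 0 < u -> 0 <= f r.+1 u)
  (f0 : forall k, (k < r)%N -> f k 0 = 0) (frc : f r 0 = c) (c0 : 0 < c).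

Let f_cont k : (k <= r.+1)%N -> {in `]0, +oo[, continuous (f k)}.
Proof.
rewrite leq_eqVlt => /predU1P[->//|]; rewrite ltnS => kr u.
rewrite in_itv/= andbT => u0; apply: differentiable_continuous; apply/derivable1_diffP.
by have [] := df kr (ltW u0).
Qed.

Let f_at0 k : (k <= r)%N -> 0 <= f k 0.
Proof. by rewrite leq_eqVlt => /predU1P[->|/f0->//]; rewrite frc ltW. Qed.

(** Downward induction from [r.+1], run on the difference [r.+1 - k]: a function with nonnegative
    value at 0 and nonnegative derivative is nonnegative. *)
Lemma derivatives_ge0 k : (k <= r.+1)%N -> forall u : R, 0 < u -> 0 <= f k u.
Proof.
move=> kr; rewrite -(subKn kr); elim: (r.+1 - k)%N (leq_subr k r.+1) => [|m IH] mr u u0.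
  by rewrite subn0 fr0.
have sr : (r.+1 - m.+1 <= r)%N by rewrite subSS leq_subr.
apply: le_trans (f_at0 sr) _.
apply: ge0_derive_nondecreasing (lexx 0) (ltW u0).
  by move=> v v0; exact: df sr v0.
by rewrite subSS -subSn//; apply: IH; exact: ltnW.
Qed.

Hypotheses (fin : laplace_finite (f 0%N))
  (hE : forall t : R, 0 < t -> h t = laplace (f 0%N) t).

(** Finiteness climbs from [f k] to [f k.+1] because [laplace_derivative] evaluates the integral of
    the latter as a real number. *)
Let f_finite k : (k <= r.+1)%N -> laplace_finite (f k).
Proof.
elim: k => // k IH kr t t0.
have dk (u : R) : 0 <= u -> is_derive u (1 : R) (f k) (f k.+1 u) by exact: df.
by rewrite (laplace_derivative dk (f_cont kr) (derivatives_ge0 kr) (f_at0 kr) (IH (ltnW kr)) t0) ltry.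
Qed.

Let f_laplaceS k t : (k <= r)%N -> 0 < t ->
  t * laplace (f k) t = f k 0 + laplace (f k.+1) t.
Proof.
move=> kr t0.
have := laplaceE (derivatives_ge0 (k := k.+1) kr) (f_finite (k := k.+1) kr) t0.
have dk (u : R) : 0 <= u -> is_derive u (1 : R) (f k) (f k.+1 u) by exact: df.
rewrite (laplace_derivative dk (f_cont (k := k.+1) kr) (derivatives_ge0 (k := k.+1) kr)
  (f_at0 kr) (f_finite (leqW kr)) t0).
by move=> [] <-; rewrite addrC subrK.
Qed.

Let f_laplaceX k t : (k <= r)%N -> 0 < t -> t ^+ k * laplace (f 0%N) t = laplace (f k) t.
Proof.
elim: k => [|k IH] kr t0; first by rewrite expr0 mul1r.
by rewrite exprS -mulrA (IH (ltnW kr) t0) (f_laplaceS (ltnW kr) t0) (f0 kr) add0r.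
Qed.

Lemma laplace_exprS t : 0 < t -> t ^+ r.+1 * h t = c + laplace (f r.+1) t.
Proof.
by move=> t0; rewrite (hE t0) exprS -mulrA (f_laplaceX (leqnn r) t0) (f_laplaceS (leqnn r) t0) frc.
Qed.

(** The degree is defined through h minus its limit at infinity, so this limit has to be identified.
    The function t^(r+1) h is completely monotonic, hence nonincreasing, hence at most its value M
    at 1 for t >= 1, and h <= M / t follows. *)
Lemma laplace_cvg0 : h t @[t --> +oo] --> (0 : R).
Proof.
have cmr : completely_monotonic (fun t => t ^+ r.+1 * h t).
  apply: (@completely_monotonic_laplace _ _ (f r.+1) c) => //; last exact: laplace_exprS.
  - exact: f_finite.
  - exact: ltW.
pose M := 1 ^+ r.+1 * h 1.
have B : \forall t \near +oo, 0 <= h t <= M * t^-1.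
  near=> t.
  have t1 : 1 <= t by near: t; apply: nbhs_pinfty_ge; exact: num_real.
  have t0 : 0 < t by exact: lt_le_trans t1.
  have ht0 : 0 <= h t by rewrite hE// laplace_ge0//; exact: derivatives_ge0.
  rewrite ht0/= ler_pdivlMr// mulrC.
  apply: (@le_trans _ _ (t ^+ r.+1 * h t)).
    by rewrite ler_wpM2r// exprS ler_peMr ?(ltW t0)// exprn_ege1.
  apply: (@derive_nonincreasing _ (fun t => t ^+ r.+1 * h t) (derive1n 1 (fun t => t ^+ r.+1 * h t))) => //.
    move=> u u0; have [d0 _] := cmr 0%N u u0.
    by rewrite derive1n1; apply: DeriveDef => //; rewrite derive1E.
  by move=> u u0; have [_] := cmr 1%N u u0; rewrite expr1 mulN1r oppr_ge0.
apply: (@squeeze_cvgr _ _ _ _ (cst 0) _ _ B 0 (cvg_cst _)).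
rewrite -(mulr0 M); apply: cvgMl_tmp.
apply/(@gtr0_cvgV0 R R +oo%R _ id); last exact: cvg_id.
by near=> x; near: x; exact: nbhs_pinfty_gt.
Unshelve. all: by end_near. Qed.

Lemma laplace_has_cm_degree : has_cm_degree h r.+1%:R.
Proof.
have l0 : lim (h t @[t --> +oo]) = 0 by apply: cvg_lim laplace_cvg0.
rewrite /has_cm_degree l0.
under eq_fun do rewrite subr0.
split.
- apply: (@completely_monotonic_laplace _ _ (f 0%N) 0) => //.
  + exact: f_cont.
  + exact: derivatives_ge0.
  + by move=> t t0; rewrite add0r hE.
- apply: (@completely_monotonic_laplace _ _ (f r.+1) c) => //.
  + exact: f_finite.
  + exact: ltW.
  + by move=> t t0; rewrite powR_mulrn ?(ltW t0)// laplace_exprS.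
move=> eps eps0.
under eq_fun do rewrite subr0.
set g := (fun x => _) => cmg.
have ni (x y : R) : 0 < x -> x <= y -> g y <= g x.
  apply: (@derive_nonincreasing _ g (derive1n 1 g)).
    move=> u u0; have [d0 _] := cmg 0%N u u0.
    by rewrite derive1n1; apply: DeriveDef => //; rewrite derive1E.
  by move=> u u0; have [_] := cmg 1%N u u0; rewrite expr1 mulN1r oppr_ge0.
have lb (t : R) : 0 < t -> c * t `^ eps <= g t.
  move=> t0; rewrite /g powRD ?(gt_eqF t0) ?implybT// powR_mulrn ?(ltW t0)//.
  rewrite mulrAC laplace_exprS// ler_wpM2r ?powR_ge0// lerDl.
  exact: laplace_ge0.
(* Chosen to satisfy c t^eps = g 1 + 1. If t >= 1, then g t >= c t^eps > g 1 contradicts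
   monotonicity; if t < 1, then c >= c t^eps > g 1 contradicts the lower bound at 1. *)
pose t := ((g 1 + 1) / c) `^ eps^-1.
have g1 : 0 <= g 1.
  by apply: le_trans (lb _ ltr01); rewrite mulr_ge0 ?powR_ge0 ?ltW.
have te : c * t `^ eps = g 1 + 1.
  rewrite /t -powRrM mulVf ?gt_eqF// powRr1 ?divr_ge0 ?addr_ge0 ?(ltW c0)//.
  by rewrite mulrCA mulfV ?mulr1// gt_eqF.
have t0 : 0 < t by rewrite powR_gt0// divr_gt0// ltr_wpDl.
have [t1|/ltW t1] := lerP 1 t.
  by have := ni _ _ ltr01 t1; have := lb _ t0; rewrite te; lra.
have t1e : t `^ eps <= 1.
  have <- : 1 `^ eps = 1 :> R by rewrite powR1.
  by rewrite ge0_ler_powR ?nnegrE ?(ltW eps0) ?(ltW t0).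
have := lb _ ltr01; rewrite powR1 mulr1.
by have : c * t `^ eps <= c * 1 by [apply: ler_wpM2l => //; exact: ltW]; rewrite te; lra.
Qed.

End degree.

Section laplace_monomials.
Context {R : realType}.
Local Notation mu := (@lebesgue_measure R).
Local Notation D := (`]0%R, +oo[%classic : set (measurableTypeR R)).

Lemma integral_expR (t : R) : 0 < t ->
  (\int[mu]_(u in D) (expR (t * - u) * 1)%:E = (t^-1)%:E)%E.
Proof.
move=> t0.
have ce : continuous (fun u : R => expR (t * - u)).
  move=> u; apply: continuous_comp; last exact: continuous_expR.
  by apply: continuousM; [exact: cst_continuous|exact: continuousN].
have L : - t^-1 * expR (t * - u) @[u --> +oo] --> (0 : R).
  rewrite -(mulr0 (- t^-1)); apply: cvgMl_tmp.
  under eq_fun do rewrite mulrN.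
  apply: (@cvg_comp _ _ _ (fun x : R => t * x) (fun x => expR (- x))); last exact: cvgr_expR.
  by apply: gt0_cvgMry.
have W0 : - t^-1 * expR (t * - u) @[u --> 0^'+] --> - t^-1 * expR (t * - 0).
  by apply: cvg_at_right_filter; apply: cvgMl_tmp; exact: ce.
have dW (u : R) : 0 < u ->
    is_derive u (1 : R) (fun u => - t^-1 * expR (t * - u)) (expR (t * - u) * 1 - (cst 0) u).
  move=> u0; apply: is_derive_eq.
  by rewrite /GRing.scale /= subr0; field; exact: lt0r_neq0.
have p0 (u : R) : 0 < u -> 0 <= expR (t * - u) * 1 by rewrite mulr1 expR_ge0.
have q0 (u : R) : 0 < u -> 0 <= (cst 0 u : R) by [].
have cp : {in `]0, +oo[, continuous (fun u : R => expR (t * - u) * 1)}.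
  by move=> u _; apply: cvgMr_tmp; exact: ce.
have cq : {in `]0, +oo[, continuous (cst 0 : R -> R)}.
  by move=> u _; exact: cst_continuous.
rewrite (ge0_integration_by_parts_0y p0 q0 cp cq dW W0 L).
by rewrite /= integral0 add0e oppr0 mulr0 expR0 mulr1 sub0r opprK.
Qed.

Lemma laplace_finite_exprn n : laplace_finite (fun u : R => u ^+ n).
Proof.
move=> t t0.
(* Up to sign, u^n e^(-t u) is the integrand of the n-th moment of the family with weight 1, whose
   finiteness is [integral_expR]. *)
have i1 : mu.-integrable D (EFin \o (fun u => (- u) ^+ n * expR (t * - u) * 1)).
  apply: integrable_moment => //.
  by move=> x x0; rewrite integral_expR// ltry.
have /integrableP[_] := i1.
apply: le_lt_trans; rewrite le_eqVlt; apply/orP; left; apply/eqP.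
apply: eq_integral => u; rewrite inE /= in_itv/= andbT => u0.
by rewrite mulr1 normrM normrX normrN !ger0_norm ?expR_ge0 ?(ltW u0)// mulrC.
Qed.

Lemma continuous_exprn n : continuous (fun u : R => u ^+ n).
Proof. by move=> u; exact: exprn_continuous. Qed.

Lemma laplace_exprn n (t : R) : 0 < t -> laplace (fun u => u ^+ n) t = n`!%:R / t ^+ n.+1.
Proof.
move=> t0; have tn0 : t != 0 by exact: lt0r_neq0.
elim: n => [|n IH].
  rewrite /laplace /Rintegral; under eq_integral do rewrite expr0.
  by rewrite integral_expR//= expr1 fact0 mul1r.
have d1 (u : R) : 0 <= u -> is_derive u (1 : R) (fun u : R => u ^+ n.+1) (n.+1%:R * u ^+ n).
  by move=> _; apply: DeriveDef; [exact: exprn_derivable|rewrite exp_derive /GRing.scale /= mulr1].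
have cd : {in `]0, +oo[, continuous (fun u : R => n.+1%:R * u ^+ n)}.
  by move=> u _; apply: cvgMl_tmp; exact: continuous_exprn.
have d0 (u : R) : 0 < u -> 0 <= n.+1%:R * u ^+ n by move=> u0; rewrite mulr_ge0 ?exprn_ge0// ltW.
have f0 : 0 <= 0 ^+ n.+1 :> R by rewrite expr0n.
have := laplace_derivative d1 cd d0 f0 (@laplace_finite_exprn n.+1) t0.
have -> : (\int[mu]_(u in D) (expR (t * - u) * (n.+1%:R * u ^+ n))%:E =
    (n.+1%:R * laplace (fun u => u ^+ n) t)%:E)%E.
  under eq_integral do rewrite mulrCA EFinM.
  have p0 (u : R) : 0 < u -> 0 <= u ^+ n by move=> u0; rewrite exprn_ge0// ltW.
  rewrite ge0_integralZl_EFin//.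
  - by rewrite (laplaceE p0 (@laplace_finite_exprn n) t0).
  - move=> u; rewrite /= in_itv/= andbT => u0.
    by rewrite lee_fin mulr_ge0 ?expR_ge0 ?p0.
  - apply/measurable_EFinP/measurable_funM; last first.
      by apply: continuous_measurable_0y => u _; exact: continuous_exprn.
    by apply: measurableT_comp => //; exact: measurable_funM.
move=> [] E.
have {}E : laplace (fun u => u ^+ n.+1) t = n.+1%:R * laplace (fun u => u ^+ n) t / t.
  by rewrite E expr0n subr0 mulrAC mulfV ?mul1r.
by rewrite E IH factS natrM (exprSr t n.+1) invfM !mulrA.
Qed.

End laplace_monomials.

(** * The Gamma, digamma and trigamma functions *)

Section gamma.
Context {R : realType}.
Local Notation mu := (@lebesgue_measure R).
Local Notation D := (`]0%R, +oo[%classic : set (measurableTypeR R)).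

(** Euler's integrand u^(x-1) e^-u equals e^(x ln u) times this weight, so all derivatives of Gamma
    are moments. *)
Definition gamma_weight (u : R) : R := expR (- u) / u.

Local Notation gamma_kernel x := (fun u : R => expR (x * ln u) * gamma_weight u).

Lemma gamma_weight_ge0 (u : R) : 0 < u -> 0 <= gamma_weight u.
Proof. by move=> u0; rewrite divr_ge0 ?expR_ge0// ltW. Qed.

Lemma continuous_expR_ln (x : R) : {in `]0, +oo[, continuous (fun u : R => expR (x * ln u))}.
Proof.
move=> u; rewrite in_itv/= andbT => u0; apply: continuous_comp; last exact: continuous_expR.
by apply: cvgMl_tmp; exact: continuous_ln.
Qed.

Lemma continuous_gamma_weight : {in `]0, +oo[, continuous gamma_weight}.
Proof.
move=> u; rewrite in_itv/= andbT => u0; apply: cvgM.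
  by apply: continuous_comp; [exact: continuousN|exact: continuous_expR].
by apply: cvgV; [exact: lt0r_neq0|exact: cvg_id].
Qed.

Lemma continuous_gamma_kernel (x : R) : {in `]0, +oo[, continuous (gamma_kernel x)}.
Proof.
by move=> u u0; apply: cvgM; [exact: continuous_expR_ln|exact: continuous_gamma_weight].
Qed.

Lemma gamma_kernel_ge0 (x u : R) : 0 < u -> 0 <= gamma_kernel x u.
Proof. by move=> u0; rewrite mulr_ge0 ?expR_ge0// gamma_weight_ge0. Qed.

Lemma expR_ln_le (x u : R) n : 0 <= x -> x <= n%:R -> 0 < u -> expR (x * ln u) <= 1 + u ^+ n.
Proof.
move=> x0 xn u0.
have [u1|u1] := lerP u 1.
  apply: (@le_trans _ _ 1); last by rewrite lerDl exprn_ge0// ltW.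
  by rewrite -[leRHS]expR0 ler_expR mulr_ge0_le0// ln_le0.
apply: (@le_trans _ _ (u ^+ n)); last by rewrite lerDr.
rewrite -[X in _ <= X ^+ _](@lnK _ u)// -expRM_natl ler_expR ler_wpM2r//.
by rewrite ln_ge0// ltW.
Qed.

Lemma gamma_kernelS (x u : R) : 0 < u -> gamma_kernel (x + 1) u = expR (x * ln u) * expR (- u).
Proof.
move=> u0; rewrite /gamma_weight mulrDl mul1r expRD lnK ?posrE//.
by field; exact: lt0r_neq0.
Qed.

Lemma gamma_functional (x : R) : 0 < x ->
  (\int[mu]_(u in D) (x * gamma_kernel x u)%:E =
   \int[mu]_(u in D) (gamma_kernel (x + 1) u)%:E)%E.
Proof.
move=> x0.
pose W u := expR (x * ln u) * expR (- u).
have W0 : W u @[u --> 0^'+] --> (0 : R).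
  suff : W u @[u --> 0^'+] --> 0 * expR (- 0 : R) by rewrite mul0r.
  apply: cvgM.
    have E : {near (0 : R)^'+, (@powR R)^~ x =1 (fun u : R => expR (x * ln u))}.
      near=> u; have u0 : 0 < u by near: u; exact: nbhs_right_gt.
      by rewrite /powR gt_eqF.
    by apply: cvg_trans (powR_cvg0 x0); apply: near_eq_cvg.
  apply: cvg_at_right_filter; apply: continuous_comp; last exact: continuous_expR.
  exact: continuousN.
have L : W u @[u --> +oo] --> (0 : R).
  (* For u >= 1, u^x <= 1 + u^n <= 2 u^n and u^(n+1) <= (n+1)! e^u; together W u <= 2 (n+1)! / u. *)
  pose n := (Num.truncn x).+1.
  have B : \forall u \near +oo, 0 <= W u <= 2 * n.+1`!%:R * u^-1.
    near=> u.
    have u1 : 1 <= u by near: u; apply: nbhs_pinfty_ge; exact: num_real.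
    have u0 : 0 < u by exact: lt_le_trans u1.
    rewrite /W mulr_ge0 ?expR_ge0//= expRN -ler_pdivlMr ?invr_gt0 ?expR_gt0// invrK.
    rewrite mulrAC ler_pdivlMr//.
    have := @exprn_le_fact_expR R n.+1 u (ltW u0).
    have := @expR_ln_le x u n (ltW x0) (ltW (truncnS_gt _)) u0.
    have un : 1 <= u ^+ n by exact: exprn_ege1.
    move=> h1; rewrite exprSr -mulrA => h2.
    apply: (@le_trans _ _ (2 * (u ^+ n * u))); last by rewrite ler_wpM2l.
    by rewrite mulrA ler_wpM2r ?(ltW u0)//; lra.
  apply: (@squeeze_cvgr _ _ _ _ (cst 0) _ _ B 0 (cvg_cst _)).
  rewrite -(mulr0 (2 * n.+1`!%:R)); apply: cvgMl_tmp.
  apply/(@gtr0_cvgV0 R R +oo%R _ id); last exact: cvg_id.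
  by near=> u; near: u; exact: nbhs_pinfty_gt.
have dW (u : R) : 0 < u -> is_derive u (1 : R) W (x * gamma_kernel x u - gamma_kernel (x + 1) u).
  move=> u0; have ? := is_derive1_ln u0.
  apply: is_derive_eq.
  rewrite gamma_kernelS// /gamma_weight /GRing.scale /=.
  by field; exact: lt0r_neq0.
have p0 (u : R) : 0 < u -> 0 <= x * gamma_kernel x u.
  by move=> u0; rewrite mulr_ge0 ?(ltW x0)// gamma_kernel_ge0.
have cp : {in `]0, +oo[, continuous (fun u => x * gamma_kernel x u)}.
  by move=> u u0; apply: cvgMl_tmp; exact: continuous_gamma_kernel.
rewrite (ge0_integration_by_parts_0y p0 (gamma_kernel_ge0 (x + 1)) cp
  (@continuous_gamma_kernel (x + 1)) dW W0 L).
by rewrite subrr adde0.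
Unshelve. all: by end_near. Qed.

(** For an exponent above 1 the kernel is at most (1 + u^n) e^-u. The singularity at 0 for small x
    is never estimated: the functional equation, valid in the extended reals, reduces x to x + 1. *)
Lemma gamma_finite (x : R) : 0 < x ->
  (\int[mu]_(u in D) (gamma_kernel x u)%:E < +oo)%E.
Proof.
have ge1 (y : R) : 0 < y -> (\int[mu]_(u in D) (gamma_kernel (y + 1) u)%:E < +oo)%E.
  move=> y0; pose n := (Num.truncn y).+1.
  have c1 k : {in `]0, +oo[, continuous (fun u : R => u ^+ k)} by move=> u _; exact: continuous_exprn.
  have m1 k : measurable_fun D (fun u : R => (expR (1 * - u) * u ^+ k)%:E).
    apply/measurable_EFinP/measurable_funM; last by apply: continuous_measurable_0y; exact: c1.
    by apply: measurableT_comp => //; exact: measurable_funM.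
  have e0 k (u : R) : D u -> (0 <= (expR (1 * - u) * u ^+ k)%:E)%E.
    by rewrite /= in_itv/= andbT => u0; rewrite lee_fin mulr_ge0 ?expR_ge0// exprn_ge0// ltW.
  apply: (@le_lt_trans _ _ (\int[mu]_(u in D) ((expR (1 * - u) * u ^+ 0)%:E +
    (expR (1 * - u) * u ^+ n)%:E))%E).
    apply: ge0_le_integral => //.
    - by move=> u; rewrite /= in_itv/= andbT => u0; rewrite lee_fin gamma_kernel_ge0.
    - apply/measurable_EFinP.
      exact: continuous_measurable_0y (@continuous_gamma_kernel (y + 1)).
    - by apply: emeasurable_funD; exact: m1.
    - move=> u; rewrite /= in_itv/= andbT => u0.
      rewrite gamma_kernelS// -EFinD lee_fin mul1r -mulrDr mulrC ler_wpM2l ?expR_ge0//.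
      rewrite expr0; apply: expR_ln_le => //; first exact: ltW.
      exact: ltW (truncnS_gt _).
  rewrite ge0_integralD//; [|exact: e0|exact: e0].
  by rewrite lte_add_pinfty ?laplace_finite_exprn.
move=> x0; have := ge1 _ x0; rewrite -gamma_functional//.
under eq_integral do rewrite EFinM.
rewrite ge0_integralZl_EFin ?(ltW x0)//.
- have : (0 <= \int[mu]_(u in D) (gamma_kernel x u)%:E)%E.
    by apply: integral_ge0 => u; rewrite /= in_itv/= andbT => u0; rewrite lee_fin gamma_kernel_ge0.
  case: (\int[mu]_(u in D) _)%E => [r _ _|_|//]; first exact: ltry.
  by rewrite gt0_muley// lte_fin.
- by move=> u; rewrite /= in_itv/= andbT => u0; rewrite lee_fin gamma_kernel_ge0.
- by apply/measurable_EFinP; exact: continuous_measurable_0y (@continuous_gamma_kernel x).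
Qed.

End gamma.

Section trigamma.
Context {R : realType}.
Local Notation mu := (@lebesgue_measure R).
Local Notation D := (`]0%R, +oo[%classic : set (measurableTypeR R)).

Definition gamma_moment (j : nat) (x : R) : R :=
  moment mu D (@ln R) gamma_weight j x.

Local Notation gamma_kernel x := (fun u : R => expR (x * ln u) * gamma_weight u).

Let measurable_lnD : measurable_fun D (@ln R).
Proof. by apply: measurable_funS (@measurable_ln R). Qed.

Let measurable_weight : measurable_fun D (@gamma_weight R).
Proof. by apply: continuous_measurable_0y; exact: continuous_gamma_weight. Qed.

Let weight_ge0 (u : R) : D u -> 0 <= gamma_weight u.
Proof. by rewrite /= in_itv/= andbT; exact: gamma_weight_ge0. Qed.

Lemma is_derive_gamma_moment j (x : R) : 0 < x ->
  is_derive x (1 : R) (gamma_moment j) (gamma_moment j.+1 x).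
Proof. by move=> x0; apply: is_derive_moment => //; exact: gamma_finite. Qed.

Lemma integrable_gamma_moment j (x : R) : 0 < x ->
  mu.-integrable D (EFin \o (fun u => ln u ^+ j * expR (x * ln u) * gamma_weight u)).
Proof. by move=> x0; apply: integrable_moment => //; exact: gamma_finite. Qed.

Lemma gamma_moment0E (x : R) : 0 < x ->
  (\int[mu]_(u in D) (gamma_kernel x u)%:E = (gamma_moment 0 x)%:E)%E.
Proof.
move=> x0; rewrite /gamma_moment /moment /Rintegral.
under [in RHS]eq_integral do rewrite expr0 mul1r.
rewrite fineK// ge0_fin_numE ?gamma_finite//.
apply: integral_ge0 => u; rewrite /= in_itv/= andbT => u0.
by rewrite lee_fin gamma_kernel_ge0.
Qed.

Lemma gamma_moment0S (x : R) : 0 < x -> gamma_moment 0 (x + 1) = x * gamma_moment 0 x.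
Proof.
move=> x0; apply: EFin_inj; rewrite -gamma_moment0E ?addr_gt0// -gamma_functional//.
under eq_integral do rewrite EFinM.
rewrite ge0_integralZl_EFin ?(ltW x0)//.
- by rewrite gamma_moment0E// EFinM.
- by move=> u; rewrite /= in_itv/= andbT => u0; rewrite lee_fin gamma_kernel_ge0.
- by apply/measurable_EFinP; exact: continuous_measurable_0y (@continuous_gamma_kernel _ x).
Qed.

Lemma gamma_moment0_gt0 (x : R) : 0 < x -> 0 < gamma_moment 0 x.
Proof.
(* On [1, 2] one has u^x >= 1, e^-u >= e^-2 and 1/u >= 1/2. *)
move=> x0; apply: (@lt_le_trans _ _ (expR (- 2) / 2)); first by rewrite divr_gt0 ?expR_gt0.
rewrite -lee_fin -gamma_moment0E//.
apply: (@integral_0y_ge _ _ 1) => //.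
- exact: continuous_gamma_kernel.
- exact: gamma_kernel_ge0.
move=> v v1 v2; have v0 : 0 < v by exact: lt_le_trans v1.
rewrite -[leLHS]mul1r ler_pM ?divr_ge0 ?expR_ge0//.
  by rewrite -[leLHS]expR0 ler_expR mulr_ge0 ?ln_ge0// ltW.
rewrite /gamma_weight ler_pM ?expR_ge0 ?invr_ge0//.
  by rewrite ler_expR lerN2; lra.
by rewrite lef_pV2 ?posrE//; lra.
Qed.

Lemma GammaE (x : R) : 0 < x -> Gamma x = gamma_moment 0 x.
Proof.
move=> x0; rewrite /Gamma x0 /euler_integral /gamma_moment /moment.
apply: eq_Rintegral => u; rewrite inE /= in_itv/= andbT => u0.
rewrite expr0 mul1r /powR (gt_eqF u0) /gamma_weight mulrBl mul1r expRB lnK ?posrE//.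
by field; exact: lt0r_neq0.
Qed.

Lemma Gamma_natS n : Gamma (n.+1%:R : R) = n`!%:R.
Proof.
rewrite GammaE ?ltr0n//; elim: n => [|n IH].
  apply: EFin_inj; rewrite -gamma_moment0E// fact0.
  have := @integral_expR R 1 ltr01; rewrite invr1 => <-.
  apply: eq_integral => u; rewrite inE /= in_itv/= andbT => u0.
  rewrite !mul1r mulr1 lnK ?posrE// /gamma_weight mulrCA mulfV ?mulr1//.
  exact: lt0r_neq0.
by rewrite -natr1 gamma_moment0S ?ltr0n// IH factS natrM.
Qed.

Definition psi (x : R) : R := gamma_moment 1 x / gamma_moment 0 x.

Definition dpsi (x : R) : R :=
  (gamma_moment 2 x * gamma_moment 0 x - gamma_moment 1 x ^+ 2) / gamma_moment 0 x ^+ 2.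

Lemma is_derive_psi (x : R) : 0 < x -> is_derive x (1 : R) psi (dpsi x).
Proof.
move=> x0.
have K0 : gamma_moment 0 x != 0 by rewrite gt_eqF// gamma_moment0_gt0.
have d0 := is_derive_gamma_moment 0 x0; have d1 := is_derive_gamma_moment 1 x0.
have dV := is_deriveV K0 d0.
rewrite /psi; apply: is_derive_eq.
by rewrite /GRing.scale /= /dpsi; field.
Qed.

(** [dpsi x] is the variance of ln u under the normalized gamma kernel. With c the mean, the moment
    of (ln u - c)^2 is expanded into the three moments 2, 1 and 0. *)
Lemma dpsi_ge0 (x : R) : 0 < x -> 0 <= dpsi x.
Proof.
move=> x0; rewrite /dpsi divr_ge0 ?sqr_ge0//.
have K0 := gamma_moment0_gt0 x0.
pose c := gamma_moment 1 x / gamma_moment 0 x.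
have I j := integrable_gamma_moment j x0.
have IZ j k : mu.-integrable D (EFin \o (fun u => k * (ln u ^+ j * expR (x * ln u) * gamma_weight u))).
  by have := @integrableZl _ _ _ mu D (measurable_itv _) k _ (I j).
have V : 0 <= gamma_moment 2 x + (- 2 * c * gamma_moment 1 x + c ^+ 2 * gamma_moment 0 x).
  rewrite /gamma_moment /moment -!RintegralZl// -!RintegralD//; last first.
    by have := @integrableD _ _ _ mu D (measurable_itv _) _ _ (IZ 1%N (- 2 * c)) (IZ 0%N (c ^+ 2)).
  apply: Rintegral_ge0 => u Du /=.
  rewrite [X in 0 <= X](_ : _ = (ln u - c) ^+ 2 * (expR (x * ln u) * gamma_weight u)); last by ring.
  by rewrite mulr_ge0 ?sqr_ge0// mulr_ge0 ?expR_ge0// weight_ge0.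
have := mulr_ge0 (ltW K0) V.
rewrite [X in 0 <= X](_ : _ = gamma_moment 2 x * gamma_moment 0 x - gamma_moment 1 x ^+ 2)//.
by rewrite /c; field; rewrite gt_eqF.
Qed.

Let near_pos (x : R) (P : R -> Prop) : 0 < x -> (forall y, 0 < y -> P y) ->
  \forall y \near x, P y.
Proof. move=> x0 HP; near=> y; apply: HP; near: y; exact: lt_nbhsr.
Unshelve. all: by end_near. Qed.

Let is_derive_uniq (f : R -> R) (x a b : R) :
  is_derive x (1 : R) f a -> is_derive x (1 : R) f b -> a = b.
Proof. by move=> [_ <-] [_ <-]. Qed.

Let is_derive_shift1 (f : R -> R) (x df : R) :
  is_derive (x + 1) (1 : R) f df -> is_derive x (1 : R) (fun y => f (y + 1)) df.
Proof.
move=> d1; have d2 : is_derive x (1 : R) (fun y => y + 1) 1.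
  by apply: is_derive_eq; rewrite addr0.
by have := @is_derive1_comp _ f (fun y => y + 1) x _ _ d1 d2; rewrite mulr1.
Qed.

Let is_derive_near (f g : R -> R) (x df : R) : 0 < x ->
  (forall y : R, 0 < y -> f y = g y) -> is_derive x (1 : R) f df -> is_derive x (1 : R) g df.
Proof.
move=> x0 fg d; apply: near_eq_is_derive d.
by apply: near_pos => // y y0; rewrite fg.
Qed.

Lemma psiS (x : R) : 0 < x -> psi (x + 1) = psi x + x^-1.
Proof.
move=> x0; have x1 : 0 < x + 1 by rewrite addr_gt0.
have d0 := is_derive_gamma_moment 0 x0.
have dl := is_derive_shift1 (is_derive_gamma_moment 0 x1).
have dr : is_derive x (1 : R) (fun y => y * gamma_moment 0 y) (gamma_moment 0 x + x * gamma_moment 1 x).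
  by apply: is_derive_eq; rewrite /GRing.scale /= mulr1 addrC.
have {}dl := is_derive_near x0 gamma_moment0S dl.
have E := is_derive_uniq dl dr.
have K0 : gamma_moment 0 x != 0 by rewrite gt_eqF// gamma_moment0_gt0.
by rewrite /psi E gamma_moment0S//; field; rewrite K0 gt_eqF.
Qed.

Lemma dpsiS (x : R) : 0 < x -> dpsi (x + 1) = dpsi x - x ^- 2.
Proof.
move=> x0; have x1 : 0 < x + 1 by rewrite addr_gt0.
have x0' : x != 0 by rewrite gt_eqF.
have d0 := is_derive_psi x0.
have dl := is_derive_shift1 (is_derive_psi x1).
have dr : is_derive x (1 : R) (fun y => psi y + y^-1) (dpsi x - x ^- 2).
  have dV := @is_deriveV _ (@id R) x 1 1 x0' _.
  by apply: is_derive_eq; rewrite /GRing.scale /= mulr1.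
exact: is_derive_uniq (is_derive_near x0 psiS dl) dr.
Qed.

Lemma trigammaE (x : R) : 0 < x -> trigamma x = dpsi x.
Proof.
move=> x0; rewrite /trigamma derive1E.
have dE (y : R) : 0 < y -> psi y = digamma y.
  move=> y0; rewrite /digamma /psi GammaE// derive1E; congr (_ / _).
  have dG : is_derive y (1 : R) Gamma (gamma_moment 1 y).
    apply: is_derive_near y0 _ (is_derive_gamma_moment 0 y0).
    by move=> z z0; rewrite GammaE.
  by have [_ ->] := dG.
by have [_ ->] := is_derive_near x0 dE (is_derive_psi x0).
Qed.

End trigamma.

(** * The trigamma function as a Laplace transform *)

Section trigamma_laplace.
Context {R : realType}.
Local Notation mu := (@lebesgue_measure R).
Local Notation D := (`]0%R, +oo[%classic : set (measurableTypeR R)).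

Definition trigamma_density (u : R) : R := u / (1 - expR (- u)).

Lemma onem_expRN_gt0 (u : R) : 0 < u -> 0 < 1 - expR (- u).
Proof. by move=> u0; rewrite subr_gt0 expR_lt1 oppr_lt0. Qed.

Lemma continuous_trigamma_density : {in `]0, +oo[, continuous trigamma_density}.
Proof.
move=> u; rewrite in_itv/= andbT => u0; apply: cvgM; first exact: cvg_id.
apply: cvgV; first by rewrite gt_eqF// onem_expRN_gt0.
apply: cvgB; first exact: cvg_cst.
by apply: continuous_comp; [exact: continuousN|exact: continuous_expR].
Qed.

Lemma trigamma_density_ge0 (u : R) : 0 < u -> 0 <= trigamma_density u.
Proof. by move=> u0; rewrite divr_ge0 ?ltW// onem_expRN_gt0. Qed.

(** This is (1 + u) e^-u <= 1. It bounds the transform of the density by 1/t + 1/t^2, which gives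
    both finiteness and decay at infinity. *)
Lemma trigamma_density_le (u : R) : 0 < u -> trigamma_density u <= 1 + u.
Proof.
move=> u0; rewrite /trigamma_density ler_pdivrMr ?onem_expRN_gt0//.
have := expR_ge1Dx u; have := expRxMexpNx_1 u; have := expR_gt0 (- u).
set e := expR (- u) => e0 h1 h2.
have : (1 + u) * e <= 1 by rewrite -[leRHS]h1 ler_wpM2r// ltW.
by lra.
Qed.

Let M t := (1 / t + 1 / t ^+ 2 : R).

Let continuous_1Did : {in `]0, +oo[, continuous (fun u : R => 1 + u)}.
Proof. by move=> u _; apply: cvgD; [exact: cvg_cst|exact: cvg_id]. Qed.

Let laplace_1Did (t : R) : 0 < t ->
  (\int[mu]_(u in D) (expR (t * - u) * (1 + u))%:E = (M t)%:E)%E.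
Proof.
move=> t0.
have m k : measurable_fun D (fun u : R => (expR (t * - u) * u ^+ k)%:E).
  apply/measurable_EFinP/measurable_funM.
    by apply: measurableT_comp => //; exact: measurable_funM.
  by apply: continuous_measurable_0y => u _; exact: continuous_exprn.
have p k (u : R) : 0 < u -> 0 <= u ^+ k by move=> u0; rewrite exprn_ge0// ltW.
have e0 k (u : R) : D u -> (0 <= (expR (t * - u) * u ^+ k)%:E)%E.
  by rewrite /= in_itv/= andbT => u0; rewrite lee_fin mulr_ge0 ?expR_ge0// p.
transitivity (\int[mu]_(u in D) ((expR (t * - u) * u ^+ 0)%:E + (expR (t * - u) * u ^+ 1)%:E))%E.
  by apply: eq_integral => u _; rewrite -EFinD -mulrDr expr0 expr1.
rewrite ge0_integralD//; [|exact: e0|exact: e0].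
rewrite (laplaceE (p 0%N) (@laplace_finite_exprn _ 0) t0).
rewrite (laplaceE (p 1%N) (@laplace_finite_exprn _ 1) t0).
by rewrite -EFinD !laplace_exprn.
Qed.

Lemma laplace_finite_trigamma_density : laplace_finite trigamma_density.
Proof.
apply: (laplace_finite_le continuous_trigamma_density continuous_1Did trigamma_density_ge0
  trigamma_density_le).
by move=> t t0; rewrite laplace_1Did// ltry.
Qed.

Let V (t : R) := laplace trigamma_density t.

Let V_ge0 t : 0 <= V t.
Proof. exact: laplace_ge0 trigamma_density_ge0. Qed.

Let me (f : R -> R) (t : R) : {in `]0, +oo[, continuous f} ->
  measurable_fun D (fun u => (expR (t * - u) * f u)%:E).
Proof.
move=> cf; apply/measurable_EFinP/measurable_funM; last exact: continuous_measurable_0y.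
by apply: measurableT_comp => //; exact: measurable_funM.
Qed.

Let V_le (t : R) : 0 < t -> V t <= M t.
Proof.
move=> t0; rewrite -lee_fin -laplace_1Did//.
rewrite -(laplaceE trigamma_density_ge0 laplace_finite_trigamma_density t0).
apply: ge0_le_integral => //.
- move=> u; rewrite /= in_itv/= andbT => u0.
  by rewrite lee_fin mulr_ge0 ?expR_ge0// trigamma_density_ge0.
- exact: me continuous_trigamma_density.
- exact: me continuous_1Did.
- move=> u; rewrite /= in_itv/= andbT => u0.
  by rewrite lee_fin ler_wpM2l ?expR_ge0// trigamma_density_le.
Qed.

(** Passing from t to t + 1 multiplies the density by e^-u, and (1 - e^-u) F(u) = u has transform
    t^-2. *)
Let VS (t : R) : 0 < t -> V (t + 1) = V t - t ^- 2.
Proof.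
move=> t0; have t1 : 0 < t + 1 by rewrite addr_gt0.
suff : V t = V (t + 1) + t ^- 2 by move=> ->; rewrite addrK.
apply: EFin_inj; rewrite EFinD.
have F0 := trigamma_density_ge0; have Fi := laplace_finite_trigamma_density.
rewrite -(laplaceE F0 Fi t0) -(laplaceE F0 Fi t1).
have p1 (u : R) : 0 < u -> 0 <= u ^+ 1 by move=> /ltW.
have -> : (t ^- 2)%:E = (\int[mu]_(u in D) (expR (t * - u) * u ^+ 1)%:E)%E.
  by rewrite (laplaceE p1 (@laplace_finite_exprn _ 1) t0) laplace_exprn// mul1r.
rewrite -ge0_integralD//.
- apply: eq_integral => u; rewrite inE /= in_itv/= andbT => u0.
  rewrite -EFinD mulrDl expRD mul1r /trigamma_density expr1; congr EFin.
  by field; rewrite gt_eqF// onem_expRN_gt0.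
- move=> u; rewrite /= in_itv/= andbT => u0.
  by rewrite lee_fin mulr_ge0 ?expR_ge0// F0.
- exact: me continuous_trigamma_density.
- move=> u; rewrite /= in_itv/= andbT => u0.
  by rewrite lee_fin mulr_ge0 ?expR_ge0// p1.
- by apply: me => u _; exact: continuous_exprn.
Qed.

Let V_continuous (t : R) : 0 < t -> {for t, continuous V}.
Proof.
move=> t0; apply: differentiable_continuous; apply/derivable1_diffP.
have [d _] := is_derive_laplace_moment 0 continuous_trigamma_density
  trigamma_density_ge0 laplace_finite_trigamma_density t0.
have -> : V = moment mu D -%R trigamma_density 0.
  by apply/funext => s; rewrite /V laplace_moment.
exact: d.
Qed.

Let dpsi_continuous (t : R) : 0 < t -> {for t, continuous (@dpsi R)}.
Proof.
move=> t0.
have c j : {for t, continuous (@gamma_moment R j)}.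
  apply: differentiable_continuous; apply/derivable1_diffP.
  by have [] := is_derive_gamma_moment j t0.
have K0 := gamma_moment0_gt0 t0.
apply: cvgM; last first.
  apply: cvgV; first by rewrite expf_neq0// gt_eqF.
  by rewrite expr2; under eq_fun do rewrite expr2; apply: cvgM; exact: c.
apply: cvgB; first by apply: cvgM; exact: c.
by rewrite expr2; under eq_fun do rewrite expr2; apply: cvgM; exact: c.
Qed.

(* d is 1-periodic and >= 0; if it were >= e > 0 on some interval [a, b] then
   psi would increase by at least (b - a) e on each [a + n, b + n], although it
   increases only by 1 / (a + n) on [a + n, a + n + 1]. *)
Lemma dpsi_laplace (t : R) : 0 < t -> dpsi t = laplace trigamma_density t.
Proof.
pose d x := dpsi x - V x.
have dn n (x : R) : 0 < x -> d (x + n%:R) = d x.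
  elim: n x => [|n IH] x x0; first by rewrite addr0.
  have xn : 0 < x + n%:R by rewrite ltr_wpDr.
  by rewrite -natr1 addrA -(IH x x0) /d (dpsiS xn) (VS xn) opprB addrA subrK.
(* By periodicity and [dpsi_ge0], - d x = - d (x + n) <= V (x + n) <= M (x + n), and the last bound
   tends to 0. *)
have d_ge0 (x : R) : 0 < x -> 0 <= d x.
  move=> x0; rewrite leNgt; apply/negP => dx0.
  pose n := (Num.truncn (2 / - d x)).+1.
  have hn : 2 / - d x < n%:R by exact: truncnS_gt.
  have n1 : 1 <= n%:R :> R by rewrite ler1n.
  have n0 : 0 < n%:R :> R by rewrite ltr0n.
  pose y := x + n%:R.
  have y0 : 0 < y by exact: addr_gt0.
  have ny : n%:R <= y by rewrite /y lerDr ltW.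
  have Mn : M y <= 2 / n%:R.
    rewrite /M [2 / _]mulrDl; apply: lerD; rewrite !mul1r lef_pV2 ?posrE ?exprn_gt0//.
    apply: (le_trans ny); rewrite expr2 ler_peMr ?(ltW y0)//.
    exact: le_trans n1 ny.
  have lt2 : 2 / n%:R < - d x by rewrite ltr_pdivrMr// mulrC -ltr_pdivrMr ?oppr_gt0.
  have dV : - d x <= V y by rewrite -(dn n x x0) /d opprB lerBlDr lerDl dpsi_ge0.
  have := le_lt_trans (le_trans dV (le_trans (V_le y0) Mn)) lt2.
  by rewrite ltxx.
move=> t0; apply/eqP; rewrite -subr_eq0 -/(V t) -/(d t); apply/negPn/negP => dt0.
have {}dt0 : 0 < d t by rewrite lt_neqAle eq_sym dt0 d_ge0.
have cd : {for t, continuous d} by apply: cvgB; [exact: dpsi_continuous|exact: V_continuous].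
have {cd} [k k0 [e e0 he]] : exists2 k : R, 0 < k &
    exists2 e : R, 0 < e & forall y, `|t - y| < e -> k < d y.
  move: dt0 cd; move: (d) => D0 dt0 cd; exists (D0 t / 2); first by rewrite divr_gt0.
  have /cvgrPdist_lt /(_ (D0 t / 2)) := cd.
  rewrite divr_gt0// => /(_ isT) /nbhs_ballP[e /= e0 he].
  exists e => // y /he /= /ltr_normlW; lra.
(* b < e keeps the interval where d > k, and b <= 1 lets the increment of psi over [x, x + b] be
   bounded by the one over [x, x + 1], which is 1/x. The n below makes 1/n smaller than k b. *)
pose b := Num.min (e / 2) 1.
have b0 : 0 < b by rewrite lt_min ltr01 divr_gt0.
have b1 : b <= 1 by rewrite ge_min lexx orbT.
have be : b < e by rewrite gt_min ltr_pdivrMr ?ltr_pMr ?ltr1n.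
pose n := (Num.truncn (b * k)^-1).+1.
have hn : (b * k)^-1 < n%:R by exact: truncnS_gt.
have n0 : 0 < n%:R :> R by rewrite ltr0n.
pose x := t + n%:R.
have x0 : 0 < x by rewrite addr_gt0.
have mono (y z : R) : 0 < y -> y <= z -> psi y <= psi z.
  move=> y0 yz; have := @derive_nonincreasing R (fun x => - psi x) (fun x => - dpsi x).
  rewrite -lerN2; apply => //.
    by move=> u u0; apply: is_deriveN; exact: is_derive_psi.
  by move=> u u0; rewrite oppr_le0 dpsi_ge0.
have xb : x < x + b by rewrite ltrDl.
have [||c] := @MVT R psi (@dpsi R) x (x + b) xb.
- by move=> z; rewrite in_itv/= => /andP[xz _]; apply: is_derive_psi; exact: lt_trans xz.
- apply: continuous_in_subspaceT => z /set_mem /=; rewrite in_itv/= => /andP[xz _].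
  apply: differentiable_continuous; apply/derivable1_diffP.
  by have [] := is_derive_psi (lt_le_trans x0 xz).
rewrite in_itv/= => /andP[xc cb] E.
have dc : k <= dpsi c.
  have cn0 : 0 < c - n%:R by rewrite subr_gt0 (lt_trans _ xc)// /x ltrDr.
  have := dn n _ cn0; rewrite subrK => Ec.
  have : k < d (c - n%:R).
    apply: he; rewrite distrC ger0_norm.
      by rewrite -addrA -opprD [n%:R + t]addrC -/x ltrBlDl (lt_trans cb)// ltrD2l.
    by rewrite -addrA -opprD [n%:R + t]addrC -/x subr_ge0 ltW.
  by rewrite -Ec => /ltW /le_trans; apply; rewrite /d lerBlDr lerDl V_ge0.
have := mono _ _ (addr_gt0 x0 b0) (lerD (lexx x) b1).
rewrite psiS// -lerBlDl E addrAC subrr add0r => h1.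
have h2 : k * b <= x^-1 by apply: le_trans h1; rewrite ler_wpM2r// ltW.
have h3 : x^-1 < n%:R^-1 by rewrite ltf_pV2 ?posrE// /x ltrDr.
have h4 : n%:R^-1 < k * b.
  by rewrite -[ltRHS]invrK ltf_pV2 ?posrE ?invr_gt0 ?mulr_gt0// mulrC.
by have := lt_trans (le_lt_trans h2 h3) h4; rewrite ltxx.
Qed.

Lemma trigamma_laplace (t : R) : 0 < t -> trigamma t = laplace trigamma_density t.
Proof. by move=> t0; rewrite trigammaE// dpsi_laplace. Qed.

End trigamma_laplace.

(** * Power series and the densities *)

Section entire_series.
Context {R : realType}.
Implicit Types (c : nat -> R).

Definition psum c (x : R) : R := limn (pseries c x).

(** Comparison with the exponential series: such series converge everywhere, and the class is stable
    under termwise differentiation, so no radius of convergence has to be tracked. *)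
Definition exp_bounded c := forall n, `|c n| <= n`!%:R^-1.

Lemma exp_bounded_cvg c x : exp_bounded c -> cvgn (pseries c x).
Proof.
move=> cb; apply: normed_cvg; rewrite /pseries /=.
apply: (@series_le_cvg _ _ (exp_coeff `|x|)); last exact: is_cvg_series_exp_coeff.
- by move=> n; exact: normr_ge0.
- by move=> n; exact: exp_coeff_ge0.
- move=> n /=; rewrite normrM normrX /exp_coeff /= mulrC.
  by rewrite ler_wpM2l// exprn_ge0.
Qed.

Lemma exp_bounded_diffs c : exp_bounded c -> exp_bounded (pseries_diffs c).
Proof.
move=> cb n; rewrite /pseries_diffs normrM normr_nat.
apply: (le_trans (ler_wpM2l _ (cb n.+1))) => //.
by rewrite factS natrM invfM mulrA mulfV ?mul1r// pnatr_eq0.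
Qed.

Lemma is_derive_psum c (x : R) : exp_bounded c ->
  is_derive x (1 : R) (psum c) (psum (pseries_diffs c) x).
Proof.
move=> cb; have cb1 := exp_bounded_diffs cb; have cb2 := exp_bounded_diffs cb1.
apply: (@pseries_snd_diffs _ _ (`|x| + 1)); try exact: exp_bounded_cvg.
by rewrite [ltRHS]ger0_norm ?addr_ge0// ltrDl.
Qed.

Lemma psum0 c : psum c 0 = c 0%N.
Proof.
apply: cvg_lim => //; rewrite -(cvg_shiftn 1).
rewrite (_ : (fun n => _) = cst (c 0%N)); first exact: cvg_cst.
apply/funext => n; rewrite addn1 /pseries /series /= big_nat_recl//= expr0 mulr1.
by rewrite big1 ?addr0// => i _; rewrite expr0n mulr0.
Qed.

Lemma psum_ge c n (x : R) : exp_bounded c -> (forall i, 0 <= c i) -> 0 <= x ->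
  \sum_(0 <= i < n) c i * x ^+ i <= psum c x.
Proof.
move=> cb c0 x0; apply: (@nondecreasing_cvgn_le _ (pseries c x)); last exact: exp_bounded_cvg.
by apply: nondecreasing_series => k _ _; rewrite mulr_ge0 ?exprn_ge0.
Qed.

Lemma psum_ge0 c (x : R) : exp_bounded c -> (forall i, 0 <= c i) -> 0 <= x -> 0 <= psum c x.
Proof. by move=> cb c0 x0; have := psum_ge 0 cb c0 x0; rewrite big_geq. Qed.

Lemma psum_le c (x y : R) : exp_bounded c -> (forall i, 0 <= c i) -> 0 <= x -> x <= y ->
  psum c x <= psum c y.
Proof.
move=> cb c0 x0 xy; apply: ler_lim; [exact: exp_bounded_cvg..|].
apply: nearW => n; rewrite /pseries /series /=; apply: ler_sum => i _.
by rewrite ler_wpM2l// lerXn2r ?nnegrE ?(le_trans x0 xy).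
Qed.

End entire_series.

Section bessel_series.
Context {R : realType}.

(** For x > 0 the sum of the resulting series is I_(k+1)(2 sqrt x) / x^((k+1)/2). *)
Definition bessel_coef (k n : nat) : R := (n`! * (n + k.+1)`!)%:R^-1.

Definition bessel_sum (k : nat) : R -> R := psum (bessel_coef k).

Lemma bessel_coef_ge0 k n : 0 <= bessel_coef k n.
Proof. by rewrite invr_ge0. Qed.

Lemma bessel_coef_bounded k : exp_bounded (bessel_coef k).
Proof.
move=> n; rewrite ger0_norm ?bessel_coef_ge0// lef_pV2 ?posrE ?ltr0n ?muln_gt0 ?fact_gt0//.
by rewrite ler_nat leq_pmulr// fact_gt0.
Qed.

Lemma bessel_coef_diffs k : pseries_diffs (bessel_coef k) = bessel_coef k.+1.
Proof.
apply/funext => n; rewrite /pseries_diffs /bessel_coef addSnnS factS -mulnA natrM invfM.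
by rewrite mulrA mulfV ?mul1r// pnatr_eq0.
Qed.

Lemma is_derive_bessel_sum k (x : R) : is_derive x (1 : R) (bessel_sum k) (bessel_sum k.+1 x).
Proof.
by rewrite /bessel_sum -bessel_coef_diffs; apply: is_derive_psum; exact: bessel_coef_bounded.
Qed.

Lemma bessel_sum0 k : bessel_sum k 0 = k.+1`!%:R^-1.
Proof. by rewrite /bessel_sum psum0 /bessel_coef fact0 mul1n add0n. Qed.

Lemma bessel_sum_ge0 k (x : R) : 0 <= x -> 0 <= bessel_sum k x.
Proof. by move=> x0; apply: psum_ge0 => //; [exact: bessel_coef_bounded|exact: bessel_coef_ge0]. Qed.

Lemma bessel_sum_le k (x y : R) : 0 <= x -> x <= y -> bessel_sum k x <= bessel_sum k y.
Proof. by apply: psum_le; [exact: bessel_coef_bounded|exact: bessel_coef_ge0]. Qed.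

Lemma continuous_bessel_sum k : continuous (bessel_sum k).
Proof.
move=> x; apply: differentiable_continuous; apply/derivable1_diffP.
by have [] := is_derive_bessel_sum k x.
Qed.

End bessel_series.

Section density_smooth.
Context {R : realType}.

(** (1 - e^-x) / x is the integral of e^(-s x) over s in [0, 1]. Its k-th derivative has the
    integrand (-s)^k e^(-s x), and integrating s^(n+k) produces the factor 1/(n+k+1). *)
Definition onem_expRN_coef (k n : nat) : R := (-1) ^+ (n + k) / (n`! * (n + k.+1))%:R.

(* The k-th derivative of (1 - expR (- x)) / x, extended to x = 0. *)
Definition onem_expRN_div (k : nat) : R -> R := psum (onem_expRN_coef k).

Local Notation g := onem_expRN_div.

Lemma onem_expRN_coef_bounded k : exp_bounded (onem_expRN_coef k).
Proof.
move=> n; rewrite normrM normfV normr_nat normrX normrN1 expr1n mul1r.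
rewrite lef_pV2 ?posrE ?ltr0n ?muln_gt0 ?fact_gt0 ?addnS//.
by rewrite ler_nat leq_pmulr.
Qed.

Lemma onem_expRN_coef_diffs k : pseries_diffs (onem_expRN_coef k) = onem_expRN_coef k.+1.
Proof.
apply/funext => n; rewrite /pseries_diffs /onem_expRN_coef !addSnnS factS -mulnA natrM invfM.
by rewrite mulrCA; congr (_ * _); rewrite mulrA mulfV ?mul1r// pnatr_eq0.
Qed.

Lemma is_derive_onem_expRN_div k (x : R) : is_derive x (1 : R) (g k) (g k.+1 x).
Proof.
rewrite /g -onem_expRN_coef_diffs; apply: is_derive_psum.
exact: onem_expRN_coef_bounded.
Qed.

Lemma onem_expRN_div0 k : g k 0 = (-1) ^+ k / k.+1%:R.
Proof. by rewrite /g psum0 /onem_expRN_coef fact0 mul1n add0n. Qed.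

Lemma onem_expRN_divE (x : R) : x * g 0 x = 1 - expR (- x).
Proof.
have cg := exp_bounded_cvg (x := x) (onem_expRN_coef_bounded 0).
have L : (x * pseries (onem_expRN_coef 0) x n) @[n --> \oo] --> x * g 0 x.
  by apply: cvgMl_tmp; exact: cg.
have E n : x * pseries (onem_expRN_coef 0) x n = 1 - series (exp_coeff (- x)) n.+1.
  rewrite /pseries /series /= big_nat_recl// /exp_coeff /= expr0 fact0 divr1 opprD addrA subrr add0r.
  rewrite big_distrr /= -sumrN; apply: eq_bigr => i _.
  rewrite /onem_expRN_coef addn0 addn1 -[(i`! * i.+1)%N]mulnC -factS.
  by rewrite [in RHS]exprS -[- x]mulN1r exprMn; ring.
have L2 : (1 - series (exp_coeff (- x)) n.+1) @[n --> \oo] --> 1 - expR (- x).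
  apply: cvgB; first exact: cvg_cst.
  have := @is_cvg_series_exp_coeff R (- x); rewrite -(cvg_shiftS (series _)).
  exact.
move: L; under eq_fun do rewrite E.
by move=> L; exact: cvg_unique L L2.
Qed.

Lemma onem_expRN_div_gt0 (x : R) : 0 <= x -> 0 < g 0 x.
Proof.
rewrite le_eqVlt => /predU1P[<-|x0]; first by rewrite onem_expRN_div0 expr0 divr1.
by rewrite -(pmulr_rgt0 _ x0) onem_expRN_divE subr_gt0 expR_lt1 oppr_lt0.
Qed.

End density_smooth.

(** * Nonnegativity of exponential polynomials *)

(* Exponential polynomials [\sum_j p_j(u) e^(j u)] are given by the list of the
   coefficient lists of p_0, p_1, ... *)
Section exponential_polynomials.

Fixpoint padd (p q : seq Z) : seq Z :=
  match p, q with
  | [::], _ => q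
  | _, [::] => p
  | a :: p', b :: q' => Z.add a b :: padd p' q'
  end.

Definition pscale (c : Z) (p : seq Z) : seq Z := [seq Z.mul c a | a <- p].

Fixpoint pderive_from (c : Z) (p : seq Z) : seq Z :=
  if p is a :: p' then Z.mul c a :: pderive_from (Z.succ c) p' else [::].

Definition pderive (p : seq Z) : seq Z := pderive_from (Zpos xH) (behead p).

(** For j = 0 the term j p is left out rather than computed: [padd] keeps the longer length, so a
    list of zeros would prevent the coefficients from ever becoming empty and being stripped. *)
Fixpoint ederive (j : Z) (L : seq (seq Z)) : seq (seq Z) :=
  if L is p :: L' then
    (if Z.eqb j Z0 then pderive p else padd (pscale j p) (pderive p)) :: ederive (Z.succ j) L'
  else [::].

Fixpoint estrip (L : seq (seq Z)) : seq (seq Z) :=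
  if L is [::] :: L' then estrip L' else L.

Definition eat0 (L : seq (seq Z)) : Z := foldr (fun p z => Z.add (head Z0 p) z) Z0 L.

(* The first k derivatives are taken as they are; afterwards, the expression is
   divided by the lowest occurring power of e^u before each derivative, so that
   the derivative eventually vanishes. *)
Fixpoint enonneg (n k : nat) (L : seq (seq Z)) : bool :=
  if n is n'.+1 then
    Z.leb Z0 (eat0 L) &&
    enonneg n' k.-1 (ederive Z0 (if k is 0%N then estrip L else L))
  else nilp L.

Section evaluation.
Context {R : realType}.

Definition zR (z : Z) : R := (int_of_Z z)%:~R.

Lemma zRD (a b : Z) : zR (Z.add a b) = zR a + zR b.
Proof. by rewrite /zR -[Z.add a b]/(a + b) rmorphD/= rmorphD. Qed.

Lemma zRM (a b : Z) : zR (Z.mul a b) = zR a * zR b.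
Proof. by rewrite /zR -[Z.mul a b]/(a * b) rmorphM/= rmorphM. Qed.

Lemma zRS (a : Z) : zR (Z.succ a) = zR a + 1.
Proof. exact: zRD a (Zpos xH). Qed.

Lemma zR_ge0 (a : Z) : Z.leb Z0 a -> 0 <= zR a.
Proof. by case: a => [|p|p]//= _; rewrite /zR ler0z. Qed.

(** Concrete coefficients unfold to short binary expressions that [ring] can normalize, without
    unary numerals. *)
Fixpoint pos_bits (p : positive) : R :=
  match p with
  | xH => 1 | xO p => 2 * pos_bits p | xI p => 1 + 2 * pos_bits p
  end.

Lemma zR_pos p : zR (Z.pos p) = pos_bits p.
Proof.
rewrite /zR /= -pmulrn; elim: p => [p IH|p IH|] //=; rewrite -IH.
  have -> : Pos.to_nat p~1 = (1 + 2 * Pos.to_nat p)%N := Pos2Nat.inj_xI p.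
  by rewrite natrD natrM.
have -> : Pos.to_nat p~0 = (2 * Pos.to_nat p)%N := Pos2Nat.inj_xO p.
by rewrite natrM.
Qed.

Lemma zR_neg p : zR (Z.neg p) = - pos_bits p.
Proof. by rewrite -zR_pos -[Z.neg p]/(- (Z.pos p)) /zR rmorphN/= rmorphN. Qed.

Fixpoint peval (p : seq Z) (u : R) : R := if p is a :: p' then zR a + u * peval p' u else 0.

Fixpoint eeval (L : seq (seq Z)) (u : R) : R :=
  if L is p :: L' then peval p u + expR u * eeval L' u else 0.

Lemma peval_add p q u : peval (padd p q) u = peval p u + peval q u.
Proof.
elim: p q => [|a p IH] [|b q] /=; rewrite ?add0r ?addr0//.
by rewrite zRD IH mulrDr addrACA.
Qed.

Lemma peval_scale c p u : peval (pscale c p) u = zR c * peval p u.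
Proof.
elim: p => [|a p IH] /=; first by rewrite mulr0.
by rewrite zRM IH mulrDr mulrCA.
Qed.

Lemma peval_derive_from c p u :
  peval (pderive_from (Z.succ c) p) u = peval (pderive_from c p) u + peval p u.
Proof.
elim: p c => [|a p IH] c /=; first by rewrite addr0.
by rewrite !zRM zRS IH; ring.
Qed.

Lemma peval_derive_cons a p u : peval (pderive (a :: p)) u = peval p u + u * peval (pderive p) u.
Proof.
have := peval_derive_from Z0 p u; rewrite -[Z.succ Z0]/(Zpos xH) /pderive /= addrC => ->.
congr (_ + _).
by case: p => [|b p] /=; rewrite ?mulr0// /zR mulr0z add0r.
Qed.

Lemma is_derive_peval p (u : R) : is_derive u (1 : R) (peval p) (peval (pderive p) u).
Proof.
elim: p => [|a p IH] /=; first exact: is_derive_cst.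
rewrite peval_derive_cons; apply: is_derive_eq.
by rewrite /GRing.scale /=; ring.
Qed.

(** [ederive j L] represents e^(-j u) times the derivative of e^(j u) [eeval L u], whence the
    correction term. The offset j is what the induction on L needs. *)
Lemma is_derive_eeval_from j L (u : R) :
  is_derive u (1 : R) (eeval L) (eeval (ederive j L) u - zR j * eeval L u).
Proof.
elim: L j => [|p L IH] j /=.
  by rewrite mulr0 subr0; exact: is_derive_cst.
have dp := is_derive_peval p u; have dL := IH (Z.succ j).
apply: is_derive_eq; rewrite /GRing.scale /= zRS.
have -> : peval (if Z.eqb j Z0 then pderive p else padd (pscale j p) (pderive p)) u =
    zR j * peval p u + peval (pderive p) u.
  case: (Z.eqb_spec j Z0) => [->|_]; first by rewrite /zR mul0r add0r.
  by rewrite peval_add peval_scale.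
by ring.
Qed.

Lemma is_derive_eeval L (u : R) : is_derive u (1 : R) (eeval L) (eeval (ederive Z0 L) u).
Proof. by have := is_derive_eeval_from Z0 L u; rewrite /zR mul0r subr0. Qed.

Lemma eeval0 L : eeval L 0 = zR (eat0 L).
Proof.
elim: L => [//|p L IH] /=; rewrite zRD IH expR0 mul1r; congr (_ + _).
by case: p => [//|a p] /=; rewrite mul0r addr0.
Qed.

Lemma eat0_strip L : eat0 (estrip L) = eat0 L.
Proof. by elim: L => [//|[|a p] L IH] //=; rewrite IH. Qed.

Lemma eeval_strip L u : (0 <= eeval (estrip L) u) -> (0 <= eeval L u).
Proof.
by elim: L => [//|[|a p] L IH] //= /IH h; rewrite add0r mulr_ge0 ?expR_ge0.
Qed.

Lemma enonnegP n k L : enonneg n k L -> forall u : R, 0 <= u -> 0 <= eeval L u.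
Proof.
elim: n k L => [|n IH] k L /=; first by move=> /nilP -> u _ /=.
move=> /andP[L0 HL] u u0.
have aux M : eat0 M = eat0 L -> enonneg n k.-1 (ederive Z0 M) -> 0 <= eeval M u.
  move=> ML HM; apply: (@le_trans _ _ (eeval M 0)); first by rewrite eeval0 ML zR_ge0.
  apply: (@ge0_derive_nondecreasing _ _ (eeval (ederive Z0 M))) => //.
    by move=> v _; exact: is_derive_eeval.
  by move=> v v0; apply: IH HM _ (ltW v0).
case: k HL aux => [|k] HL aux; last exact: aux.
by apply: eeval_strip; apply: aux => //; exact: eat0_strip.
Qed.

End evaluation.
End exponential_polynomials.

Lemma density4_numerator_ge0 (R : realType) (u : R) : 0 <= u ->
  0 <= (6 + u) * (expR u - 1) ^+ 5
    - 720 * u * (expR u ^+ 4 + 11 * expR u ^+ 3 + 11 * expR u ^+ 2 + expR u)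
    + 2880 * (expR u ^+ 4 + 3 * expR u ^+ 3 - 3 * expR u ^+ 2 - expR u).
Proof.
move=> u0.
(* The factor e^(11 u) is chosen such that the first 56 derivatives at 0 are >= 0. *)
pose L := ncons 11 [::] [::
  [:: Z.neg 6; Z.neg 1]; [:: Z.neg 2850; Z.neg 715]; [:: Z.neg 8700; Z.neg 7930];
  [:: Z.pos 8700; Z.neg 7910]; [:: Z.pos 2850; Z.neg 725]; [:: Z.pos 6; Z.pos 1]].
(* After the 56 plain derivatives, two more annihilate each of the six linear coefficients, so 70
   steps suffice. *)
have HL : enonneg 70 56 L by vm_compute.
have := enonnegP HL u0.
rewrite /L /= !zR_pos !zR_neg /=.
have E0 := expR_gt0 u; set E := expR u in E0 *.
rewrite !add0r !(pmulr_rge0 _ E0).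
by congr (0 <= _); ring.
Qed.

(** * Derivatives of the density of the trigamma function *)

Section density_derivatives.
Context {R : realType}.
Local Notation g := (@onem_expRN_div R).

(** The derivative of order k+1 of x g(x) = 1 - e^-x, by Leibniz. For u > 0 these relations express
    all g k u rationally in u and e^u. *)
Lemma onem_expRN_divS k (u : R) :
  u * g k.+1 u + k.+1%:R * g k u = (-1) ^+ k * expR (- u).
Proof.
have uniq (f : R -> R) (x a b : R) :
  is_derive x (1 : R) f a -> is_derive x (1 : R) f b -> a = b by move=> [_ <-] [_ <-].
elim: k u => [|k IH] u.
  have d0 := is_derive_onem_expRN_div 0 u.
  have dl : is_derive u (1 : R) (fun x => x * g 0 x) (u * g 1 u + g 0 u).
    by apply: is_derive_eq; rewrite /GRing.scale /= mulr1.
  have dr : is_derive u (1 : R) (fun x => 1 - expR (- x)) (expR (- u)).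
    by apply: is_derive_eq; rewrite /GRing.scale /=; ring.
  have E : (fun x => x * g 0 x) = (fun x => 1 - expR (- x)).
    by apply/funext => x; exact: onem_expRN_divE.
  by rewrite expr0 !mul1r; rewrite E in dl; exact: uniq dl dr.
have d0 := is_derive_onem_expRN_div k u; have d1 := is_derive_onem_expRN_div k.+1 u.
have dl : is_derive u (1 : R) (fun x => x * g k.+1 x + k.+1%:R * g k x)
    (u * g k.+2 u + k.+2%:R * g k.+1 u).
  by apply: is_derive_eq; rewrite /GRing.scale /= -[k.+2%:R]natr1; ring.
have dr : is_derive u (1 : R) (fun x => (-1) ^+ k * expR (- x)) ((-1) ^+ k.+1 * expR (- u)).
  by apply: is_derive_eq; rewrite /GRing.scale /= exprS; ring.
have E : (fun x => x * g k.+1 x + k.+1%:R * g k x) = (fun x => (-1) ^+ k * expR (- x)).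
  by apply/funext => x; exact: IH.
by rewrite E in dl; exact: uniq dl dr.
Qed.

(* F^(k) for F = 1 / onem_expRN_div 0, with junk values for k > 4. *)
Definition density_derive (k : nat) (u : R) : R :=
  match k with
  | 0 => (g 0 u)^-1
  | 1 => - g 1 u * (g 0 u) ^- 2
  | 2 => 2 * g 1 u ^+ 2 * (g 0 u) ^- 3 - g 2 u * (g 0 u) ^- 2
  | 3 => - 6 * g 1 u ^+ 3 * (g 0 u) ^- 4 + 6 * g 1 u * g 2 u * (g 0 u) ^- 3
         - g 3 u * (g 0 u) ^- 2
  | 4 => 24 * g 1 u ^+ 4 * (g 0 u) ^- 5 - 36 * g 1 u ^+ 2 * g 2 u * (g 0 u) ^- 4
         + (6 * g 2 u ^+ 2 + 8 * g 1 u * g 3 u) * (g 0 u) ^- 3 - g 4 u * (g 0 u) ^- 2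
  | _ => 0
  end.

Lemma is_derive_density k (u : R) : (k < 4)%N -> 0 <= u ->
  is_derive u (1 : R) (density_derive k) (density_derive k.+1 u).
Proof.
move=> k4 u0; have g0 : g 0 u != 0 by rewrite gt_eqF// onem_expRN_div_gt0.
have d0 := is_derive_onem_expRN_div 0 u; have d1 := is_derive_onem_expRN_div 1 u.
have d2 := is_derive_onem_expRN_div 2 u; have d3 := is_derive_onem_expRN_div 3 u.
(* Negative powers are differentiated once here; in the four cases below they are atoms and [ring]
   is enough. *)
have dV n : is_derive u (1 : R) (fun x => (g 0 x) ^- n) (- n%:R * g 1 u * (g 0 u) ^- n.+1).
  have dX : is_derive u (1 : R) (fun x => g 0 x ^+ n) (n%:R * g 0 u ^+ n.-1 * g 1 u).
    have := is_deriveX n d0; rewrite fctE => dX; apply: is_derive_eq.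
    by rewrite /GRing.scale /= mulr_natl mulrC.
  have dV := @is_deriveV R (fun x => g 0 x ^+ n) u _ 1 (expf_neq0 n g0) dX; apply: is_derive_eq.
  rewrite /GRing.scale /=; case: n {dX dV} => [|n]; first by rewrite !mul0r !mulr0 oppr0 !mul0r.
  by rewrite /= !exprS; field; rewrite expf_neq0 ?g0.
have := dV 1%N; have := dV 2%N; have := dV 3%N; have := dV 4%N => dV4 dV3 dV2 dV1.
case: k k4 => [|[|[|[|//]]]] _; rewrite /density_derive.
- rewrite (_ : (fun u => _) = (fun x => g 0 x ^- 1)) //.
  by apply: is_derive_eq; rewrite /GRing.scale /=; ring.
- apply: is_derive_eq; rewrite /GRing.scale /=; ring.
- apply: is_derive_eq; rewrite /GRing.scale /=; ring.
- apply: is_derive_eq; rewrite /GRing.scale /=; ring.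
Qed.

Lemma continuous_density4 : {in `]0, +oo[, continuous (density_derive 4)}.
Proof.
move=> u; rewrite in_itv/= andbT => u0.
have g0 : g 0 u != 0 by rewrite gt_eqF// onem_expRN_div_gt0// ltW.
have c k : {for u, continuous (g k)}.
  apply: differentiable_continuous; apply/derivable1_diffP.
  by have [] := is_derive_onem_expRN_div k u.
have cX k n : {for u, continuous (fun x => g k x ^+ n)}.
  exact: (@continuous_comp _ _ _ (g k) (fun x => x ^+ n) u (c k) (@exprn_continuous _ n _)).
have cV n : {for u, continuous (fun x => g 0 x ^- n)}.
  by apply: cvgV; [exact: expf_neq0|exact: cX].
have cc (a : R) : {for u, continuous (fun=> a)} by exact: cst_continuous.
rewrite /density_derive.
apply: cvgB; first apply: cvgD; first apply: cvgB.
- by apply: cvgM; [apply: cvgM; [exact: cc|exact: cX]|exact: cV].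
- by apply: cvgM; [apply: cvgM; [apply: cvgM; [exact: cc|exact: cX]|exact: c]|exact: cV].
- apply: cvgM; last exact: cV.
  apply: cvgD; first by apply: cvgM; [exact: cc|exact: cX].
  by apply: cvgM; [apply: cvgM; [exact: cc|exact: c]|exact: c].
- by apply: cvgM; [exact: c|exact: cV].
Qed.

(** The third derivative vanishes because F(u) - u/2 = (u/2) coth(u/2) is even. *)
Lemma density_derive_at0 :
  [/\ density_derive 0 0 = 1, density_derive 1 0 = 2^-1, density_derive 2 0 = 6^-1
    & density_derive 3 0 = 0].
Proof.
by rewrite /density_derive !onem_expRN_div0 !(expr0, expr1); split; field.
Qed.

Lemma density_derive0E (u : R) : 0 < u -> density_derive 0 u = trigamma_density u.
Proof.
move=> u0; rewrite /density_derive /trigamma_density -onem_expRN_divE.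
by field; rewrite (gt_eqF u0) gt_eqF// onem_expRN_div_gt0// ltW.
Qed.

Lemma density_derive1E (u : R) : 0 < u -> density_derive 1 u = derive1 trigamma_density u.
Proof.
move=> u0; rewrite derive1E.
have d := is_derive_density (k := 0%N) isT (ltW u0).
rewrite -(@near_eq_derive _ _ _ (density_derive 0)); first by have [_ ->] := d.
by near=> y; rewrite density_derive0E//; near: y; exact: lt_nbhsr.
Unshelve. all: by end_near. Qed.

(** Pure algebra, with E for e^u and a0, ..., a4 for the values of g and its derivatives: the
    recurrences are solved one after the other and substituted. *)
Let density4_explicit (u E a0 a1 a2 a3 a4 : R) : u != 0 -> E != 0 -> E - 1 != 0 ->
  u * a0 = 1 - E^-1 -> u * a1 + a0 = E^-1 -> u * a2 + 2 * a1 = - E^-1 ->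
  u * a3 + 3 * a2 = E^-1 -> u * a4 + 4 * a3 = - E^-1 ->
  120^-1 + u / 720 - (24 * a1 ^+ 4 * a0 ^- 5 - 36 * a1 ^+ 2 * a2 * a0 ^- 4
         + (6 * a2 ^+ 2 + 8 * a1 * a3) * a0 ^- 3 - a4 * a0 ^- 2) =
  ((6 + u) * (E - 1) ^+ 5
    - 720 * u * (E ^+ 4 + 11 * E ^+ 3 + 11 * E ^+ 2 + E)
    + 2880 * (E ^+ 4 + 3 * E ^+ 3 - 3 * E ^+ 2 - E)) / (720 * (E - 1) ^+ 5).
Proof.
move=> u0 E0 E1 r0 r1 r2 r3 r4.
have solve (x y z : R) : u * x + y = z -> x = (z - y) / u.
  by move=> <-; rewrite addrK mulrAC mulfV ?mul1r.
have h0 : a0 = (E - 1) / (E * u) by apply: (mulfI u0); rewrite r0; field; rewrite E0 u0.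
have h1 := solve _ _ _ r1; have h2 := solve _ _ _ r2.
have h3 := solve _ _ _ r3; have h4 := solve _ _ _ r4.
by rewrite h4 h3 h2 h1 h0; field; rewrite ?E0 ?E1 ?u0.
Qed.

Lemma density4_le (u : R) : 0 < u -> density_derive 4 u <= 120^-1 + u / 720.
Proof.
move=> u0; rewrite -subr_ge0 /density_derive.
have E1 : 1 < expR u by rewrite expR_gt1.
have Q := density4_numerator_ge0 (ltW u0).
have r0 := onem_expRN_divE u; have r1 := onem_expRN_divS 0 u.
have r2 := onem_expRN_divS 1 u; have r3 := onem_expRN_divS 2 u.
have r4 := onem_expRN_divS 3 u.
rewrite expRN in r0 r1 r2 r3 r4.
rewrite expr0 !mul1r in r1; rewrite expr1 mulN1r in r2.
rewrite sqrrN expr1n mul1r in r3; rewrite exprS sqrrN expr1n mulr1 mulN1r in r4.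
have u0' : u != 0 by rewrite gt_eqF.
have E0 : expR u != 0 by rewrite gt_eqF ?expR_gt0.
have E10 : expR u - 1 != 0 by rewrite gt_eqF ?subr_gt0.
rewrite (density4_explicit u0' E0 E10 r0 r1 r2 r3 r4).
apply: divr_ge0; first exact: Q.
by apply: mulr_ge0; [exact: ler0n|rewrite exprn_ge0// subr_ge0 ltW].
Qed.

End density_derivatives.

Lemma eseries_EFin (R : realType) (a : nat -> R) (l : R) :
  series a n @[n --> \oo] --> l -> (\sum_(0 <= n <oo) (a n)%:E = l%:E)%E.
Proof.
move=> al; apply: cvg_lim => //.
apply: (@cvg_EFin _ _ _ _ (fun n => (\sum_(0 <= i < n) (a i)%:E)%E)).
  by apply: nearW => n; rewrite sumEFin.
apply: cvg_trans al; apply: near_eq_cvg; apply: nearW => n.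
by rewrite /= sumEFin.
Qed.

(** * Laplace transforms of power series *)

Section laplace_series.
Context {R : realType}.
Local Notation mu := (@lebesgue_measure R).
Local Notation D := (`]0%R, +oo[%classic : set (measurableTypeR R)).

(** Nonnegative terms can be integrated one by one, so finiteness of the integral results from the
    convergence of a numerical series. *)
Lemma integral_laplace_psum (c : nat -> R) (s t l : R) :
  exp_bounded c -> (forall n, 0 <= c n) -> 0 <= s -> 0 < t ->
  series (fun n => c n * s ^+ n * (n`!%:R / t ^+ n.+1)) n @[n --> \oo] --> l ->
  (\int[mu]_(u in D) (expR (t * - u) * psum c (s * u))%:E = l%:E)%E.
Proof.
move=> cb c0 s0 t0 sl.
pose f n (u : R) := expR (t * - u) * (c n * s ^+ n * u ^+ n).
have k0 n : 0 <= c n * s ^+ n by rewrite mulr_ge0 ?exprn_ge0.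
have f0 n (u : R) : D u -> 0 <= f n u.
  by rewrite /= in_itv/= andbT => u0; rewrite !mulr_ge0 ?expR_ge0 ?exprn_ge0// ltW.
have m n : measurable_fun D (fun u : R => expR (t * - u) * u ^+ n).
  apply: measurable_funM.
    by apply: measurableT_comp => //; exact: measurable_funM.
  by apply: continuous_measurable_0y => u _; exact: continuous_exprn.
have fE n (u : R) : f n u = c n * s ^+ n * (expR (t * - u) * u ^+ n).
  by rewrite /f mulrCA.
transitivity (\int[mu]_(u in D) \sum_(0 <= n <oo) (f n u)%:E)%E.
  apply: eq_integral => u _; apply/esym/eseries_EFin.
  have : expR (t * - u) * pseries c (s * u) n @[n --> \oo] --> expR (t * - u) * psum c (s * u).
    by apply: cvgMl_tmp; exact: exp_bounded_cvg.
  apply: cvg_trans; apply: near_eq_cvg; apply: nearW => n.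
  rewrite /pseries /series /= big_distrr /=; apply: eq_bigr => i _.
  by rewrite /f exprMn !mulrA.
rewrite integral_nneseries//.
- rewrite -(eseries_EFin sl); apply: eq_eseriesr => n _.
  under eq_integral do rewrite fE EFinM.
  have p0 (u : R) : 0 < u -> 0 <= u ^+ n by move=> u0; rewrite exprn_ge0// ltW.
  rewrite ge0_integralZl_EFin//.
  + by rewrite (laplaceE p0 (@laplace_finite_exprn _ n) t0) laplace_exprn// EFinM.
  + move=> u; rewrite /= in_itv/= andbT => u0.
    by rewrite lee_fin mulr_ge0 ?expR_ge0 ?p0.
  + by apply/measurable_EFinP; exact: m.
- move=> n; apply/measurable_EFinP; rewrite (funext (fE n)).
  by apply: measurable_funM => //; exact: m.
Qed.

Lemma continuous_bessel_sum_scaled k (a b : R) : continuous (fun u : R => a * bessel_sum k (b * u)).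
Proof.
move=> u; apply: cvgMl_tmp; apply: (@continuous_comp _ _ _ (fun u => b * u) (bessel_sum k)).
  by apply: cvgMl_tmp; exact: cvg_id.
exact: continuous_bessel_sum.
Qed.

(** The n-th integrated term is (b/t)^(n+1) / (n+1)! up to the factor 1/b: the exponential series of
    b/t without its constant term, which accounts for the - alpha in H. *)
Lemma integral_laplace_bessel (a b t : R) : 0 < a -> 0 < b -> 0 < t ->
  (\int[mu]_(u in D) (expR (t * - u) * (a * b * bessel_sum 0 (b * u)))%:E =
   (a * (expR (b / t) - 1))%:E)%E.
Proof.
move=> a0 b0 t0; have tn0 : t != 0 by rewrite gt_eqF.
have S : series (fun n => bessel_coef 0 n * b ^+ n * (n`!%:R / t ^+ n.+1)) n
    @[n --> \oo] --> (expR (b / t) - 1) / b.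
  have ce : series (exp_coeff (b / t)) n.+1 @[n --> \oo] --> expR (b / t).
    by have := @is_cvg_series_exp_coeff R (b / t); rewrite -(cvg_shiftS (series _)).
  have : (series (exp_coeff (b / t)) n.+1 - 1) / b @[n --> \oo] --> (expR (b / t) - 1) / b.
    by apply: cvgMr_tmp; apply: cvgB => //; exact: cvg_cst.
  apply: cvg_trans; apply: near_eq_cvg; apply: nearW => n.
  rewrite /series /= big_nat_recl// {1}/exp_coeff /= expr0 fact0 divr1 addrAC subrr add0r.
  rewrite big_distrl /=; apply: eq_bigr => i _.
  rewrite /exp_coeff /bessel_coef /= addn1 expr_div_n natrM (exprS b i).
  have h1 : i`!%:R != 0 :> R by rewrite pnatr_eq0 -lt0n fact_gt0.
  have h2 : i.+1`!%:R != 0 :> R by rewrite pnatr_eq0 -lt0n fact_gt0.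
  have h3 : t ^+ i.+1 != 0 by rewrite expf_neq0.
  by field; rewrite h1 h2 h3 gt_eqF.
have E := integral_laplace_psum (@bessel_coef_bounded R 0) (bessel_coef_ge0 0) (ltW b0) t0 S.
transitivity (\int[mu]_(u in D) ((a * b)%:E * (expR (t * - u) * bessel_sum 0 (b * u))%:E))%E.
  by apply: eq_integral => u _; rewrite -EFinM; congr EFin; ring.
rewrite ge0_integralZl_EFin ?mulr_ge0 ?(ltW a0) ?(ltW b0)//.
- by rewrite /bessel_sum E -EFinM; congr EFin; field; rewrite gt_eqF.
- move=> u; rewrite /= in_itv/= andbT => u0.
  by rewrite lee_fin mulr_ge0 ?expR_ge0// bessel_sum_ge0// mulr_ge0// ltW.
- apply/measurable_EFinP/measurable_funM.
    by apply: measurableT_comp => //; exact: measurable_funM.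
  apply: continuous_measurable_0y => u _.
  by have := @continuous_bessel_sum_scaled 0 1 b u; under eq_fun do rewrite mul1r.
Qed.

End laplace_series.

(** * The degree of H *)

Section degree_of_H.
Context {R : realType}.
Local Notation mu := (@lebesgue_measure R).
Local Notation D := (`]0%R, +oo[%classic : set (measurableTypeR R)).

Lemma besselI2E (x : R) : 0 < x -> besselI 2 (2 * Num.sqrt x) = x * bessel_sum 1 x.
Proof.
move=> x0; rewrite /besselI; apply: cvg_lim => //.
have : x * pseries (bessel_coef 1) x n @[n --> \oo] --> x * bessel_sum 1 x.
  by apply: cvgMl_tmp; apply: exp_bounded_cvg; exact: bessel_coef_bounded.
apply: cvg_trans; apply: near_eq_cvg; apply: nearW => n.
rewrite /pseries /series /= big_distrr /=; apply: eq_bigr => k _.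
have -> : 2 + k%:R + 1 = (2 + k).+1%:R :> R by rewrite -[in RHS]addn1 !natrD.
rewrite [(2 + k)%N]addnC Gamma_natS /bessel_coef natrM.
have -> : 2 * Num.sqrt x / 2 = Num.sqrt x by rewrite mulrAC mulfV ?mul1r.
have -> : (2 * k)%:R + 2 = (2 * k.+1)%:R :> R by rewrite mulnS addnC natrD.
rewrite powR_mulrn ?sqrtr_ge0// exprM sqr_sqrtr ?(ltW x0)// exprS.
by rewrite mulrCA.
Qed.

Variables (a b : R).
Hypotheses (a0 : 0 < a) (b0 : 0 < b).

Definition H_density (k : nat) (u : R) : R :=
  a * b ^+ k.+1 * bessel_sum k (b * u) - density_derive k u.

Lemma is_derive_H_density k (u : R) : (k < 4)%N -> 0 <= u ->
  is_derive u (1 : R) (H_density k) (H_density k.+1 u).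
Proof.
move=> k4 u0; have dF := is_derive_density k4 u0.
have db : is_derive u (1 : R) (fun x => b * x) b by apply: is_derive_eq; rewrite /GRing.scale /= mulr1.
have dB := @is_derive1_comp _ _ (fun x => b * x) u _ _ (is_derive_bessel_sum k (b * u)) db.
rewrite /comp /= in dB.
rewrite /H_density; apply: is_derive_eq; rewrite /GRing.scale /= [in RHS]exprSr; ring.
Qed.

Lemma continuous_H_density k : (k <= 4)%N -> {in `]0, +oo[, continuous (H_density k)}.
Proof.
move=> k4 u u0; apply: cvgB; first exact: continuous_bessel_sum_scaled.
move: k4; rewrite leq_eqVlt => /predU1P[->|k4]; first exact: continuous_density4.
move: u0; rewrite in_itv/= andbT => u0.
apply: differentiable_continuous; apply/derivable1_diffP.
by have [] := is_derive_density k4 (ltW u0).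
Qed.

(** The difference of transforms is read as a sum p = h + F of nonnegative functions, so that
    integrals add; h <= p gives the finiteness. *)
Lemma H_laplace : (forall u : R, 0 < u -> 0 <= H_density 0 u) ->
  laplace_finite (H_density 0) /\ forall t : R, 0 < t -> H a b t = laplace (H_density 0) t.
Proof.
move=> h0.
have c0 := continuous_H_density (k := 0%N) isT.
pose p u := a * b * bessel_sum 0 (b * u).
have cp : {in `]0, +oo[, continuous p} by move=> u _; exact: continuous_bessel_sum_scaled.
have pE (u : R) : 0 < u -> p u = H_density 0 u + trigamma_density u.
  by move=> u0; rewrite /H_density expr1 density_derive0E// subrK.
have Hf : laplace_finite (H_density 0).
  apply: (laplace_finite_le c0 cp h0).
    by move=> u u0; rewrite pE// lerDl trigamma_density_ge0.
  by move=> t t0; rewrite integral_laplace_bessel// ltry.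
split=> // t t0; rewrite /H trigamma_laplace//.
have me (f : R -> R) : {in `]0, +oo[, continuous f} ->
    measurable_fun D (fun u => (expR (t * - u) * f u)%:E).
  move=> cf; apply/measurable_EFinP/measurable_funM; last exact: continuous_measurable_0y.
  by apply: measurableT_comp => //; exact: measurable_funM.
have := integral_laplace_bessel a0 b0 t0.
have -> : (\int[mu]_(u in D) (expR (t * - u) * (a * b * bessel_sum 0 (b * u)))%:E =
  \int[mu]_(u in D) ((expR (t * - u) * H_density 0 u)%:E + (expR (t * - u) * trigamma_density u)%:E))%E.
  apply: eq_integral => u; rewrite inE /= in_itv/= andbT => u0.
  by rewrite -EFinD -mulrDr -pE.
rewrite ge0_integralD//.
- rewrite (laplaceE h0 Hf t0) (laplaceE trigamma_density_ge0 laplace_finite_trigamma_density t0).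
  by rewrite -EFinD => -[E]; rewrite -[RHS](addrK (laplace trigamma_density t)) E; ring.
- move=> u; rewrite /= in_itv/= andbT => u0.
  by rewrite lee_fin mulr_ge0 ?expR_ge0// h0.
- exact: me.
- move=> u; rewrite /= in_itv/= andbT => u0.
  by rewrite lee_fin mulr_ge0 ?expR_ge0// trigamma_density_ge0.
- exact: me continuous_trigamma_density.
Qed.

Lemma H_has_cm_degree (r : nat) : (r < 4)%N ->
  (forall k, (k < r)%N -> H_density k 0 = 0) -> 0 < H_density r 0 ->
  (forall u : R, 0 < u -> 0 <= H_density r.+1 u) ->
  has_cm_degree (H a b) r.+1%:R.
Proof.
move=> r4 hk hr hS.
have dh k (u : R) : (k <= r)%N -> 0 <= u ->
    is_derive u (1 : R) (H_density k) (H_density k.+1 u).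
  by move=> kr u0; apply: is_derive_H_density => //; exact: leq_ltn_trans r4.
have h0 := derivatives_ge0 dh hS hk (erefl _) hr (k := 0%N) isT.
have [hf hE] := H_laplace h0.
apply: (laplace_has_cm_degree dh _ hS hk (erefl _) hr hf hE).
exact: continuous_H_density.
Qed.

End degree_of_H.

(** The bound on F'''' consists of the first two terms of B_4, with coefficients 1/(0! 5!) = 1/120
    and 1/(1! 6!) = 1/720; the other terms are nonnegative. *)
Lemma H_density4_ge0 (R : realType) (u : R) : 0 < u -> 0 <= H_density 1 1 4 u.
Proof.
move=> u0; rewrite /H_density expr1n !mul1r subr_ge0.
apply: le_trans (density4_le u0) _.
have := psum_ge 2 (@bessel_coef_bounded R 4) (bessel_coef_ge0 4) (ltW u0).
apply: le_trans; rewrite big_nat_recl// big_nat1 /bessel_coef expr0 expr1.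
have -> : (0`! * (0 + 5)`! = 120)%N by [].
have -> : (1`! * (1 + 5)`! = 720)%N by [].
by rewrite mulr1 mulrC.
Qed.

Lemma H_density_at0 (R : realType) (a b : R) :
  [/\ H_density a b 0 0 = a * b - 1, H_density a b 1 0 = (a * b ^+ 2 - 1) / 2,
      H_density a b 2 0 = (a * b ^+ 3 - 1) / 6 & H_density a b 3 0 = a * b ^+ 4 / 24].
Proof.
have [d0 d1 d2 d3] := @density_derive_at0 R.
rewrite /H_density mulr0 !bessel_sum0 d0 d1 d2 d3.
by split; rewrite !factS fact0; field.
Qed.

Lemma H_density11_ge0 (R : realType) k (u : R) : (k <= 4)%N -> 0 < u -> 0 <= H_density 1 1 k u.
Proof.
move=> k4 u0; have [d0 d1 d2 d3] := @H_density_at0 R 1 1.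
apply: (@derivatives_ge0 R (H_density 1 1) 3 24^-1) => //.
- by move=> j v j3 v0; apply: is_derive_H_density.
- exact: H_density4_ge0.
- by case=> [|[|[|//]]] _; rewrite ?d0 ?d1 ?d2 ?expr1n mulr1 subrr ?mul0r.
- by rewrite d3 expr1n mulr1 mul1r.
Qed.

(** B_k is nonnegative and nondecreasing on the half-line, so replacing B_k(u) by a b^(k+1) B_k(b u)
    only increases it. This reduces beta >= 1 to alpha = beta = 1. *)
Lemma H_density_ge11 (R : realType) (a b : R) k (u : R) :
  1 <= b -> 1 <= a * b ^+ k.+1 -> 0 < u -> H_density 1 1 k u <= H_density a b k u.
Proof.
move=> b1 ab1 u0; rewrite /H_density lerD2r expr1n !mul1r.
have u0' := ltW u0.
rewrite -[leLHS]mul1r ler_pM// ?bessel_sum_ge0// bessel_sum_le// ler_peMl//.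
Qed.

Theorem theorem1p3 (R : realType) (alpha beta : R) :
  0 < alpha -> 0 < beta ->
  [/\ alpha = 1 -> beta = 1 -> has_cm_degree (H alpha beta) 4,
      alpha = beta^-1 -> 1 < beta -> has_cm_degree (H alpha beta) 2 &
      (1 < alpha * beta /\ 1 <= beta) \/
      [/\ 1 < alpha * beta, 0 < beta < 1 &
          exists2 M : R, is_maximum_on `]0, +oo[ (G beta) M
                       & M <= alpha * beta ^+ 2] ->
      has_cm_degree (H alpha beta) 1].
Proof.
move=> a0 b0; have [d0 d1 d2 d3] := H_density_at0 alpha beta.
split.
- move=> a1 b1; subst alpha beta; rewrite !expr1n !mulr1 in d0 d1 d2 d3.
  apply: (@H_has_cm_degree R 1 1 ltr01 ltr01 3) => //.
  + by case=> [|[|[|//]]] _; rewrite ?d0 ?d1 ?d2 subrr ?mul0r.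
  + by rewrite d3 divr_gt0.
  + exact: H_density4_ge0.
- move=> ab b1.
  have abE : alpha * beta = 1 by rewrite ab mulVf// gt_eqF.
  have ab2 : alpha * beta ^+ 2 = beta by rewrite expr2 mulrA abE mul1r.
  apply: (H_has_cm_degree a0 b0 (r := 1)) => //.
  + by case=> [|//] _; rewrite d0 abE subrr.
  + by rewrite d1 ab2 divr_gt0// subr_gt0.
  (* The comparison applies because alpha beta^3 = beta^2 >= 1. *)
  + move=> u u0; apply: le_trans (H_density11_ge0 (k := 2%N) isT u0) _.
    apply: H_density_ge11 => //; first exact: ltW.
    by rewrite exprS mulrCA ab2 -[leLHS]mul1r ler_pM// ltW.
move=> hyp; apply: (H_has_cm_degree a0 b0 (r := 0)) => //.
  by rewrite d0 subr_gt0; case: hyp => -[].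
move=> u u0; case: hyp => [[ab1 b1]|[ab1 /andP[_ b1] [M [_ Mub] Mle]]].
  apply: le_trans (H_density11_ge0 (k := 1%N) isT u0) _.
  apply: H_density_ge11 => //.
  by rewrite expr2 mulrA -[leLHS]mul1r ler_pM// ltW.
have bu0 : 0 < beta * u by rewrite mulr_gt0.
have B0 : 0 < bessel_sum 1 (beta * u).
  apply: lt_le_trans (bessel_sum_le 1 (lexx 0) (ltW bu0)).
  by rewrite bessel_sum0 invr_gt0 ltr0n fact_gt0.
(* I_2(2 sqrt(beta u)) = beta u B_1(beta u), so the factor beta u in G cancels and G <= alpha beta^2
   becomes nonnegativity of [H_density alpha beta 1]. *)
have GE : G beta u = density_derive 1 u / bessel_sum 1 (beta * u).
  rewrite /G besselI2E// density_derive1E// /trigamma_density.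
  by field; rewrite !gt_eqF.
have : G beta u <= alpha * beta ^+ 2.
  by apply: le_trans Mle; apply: Mub; exists u => //; rewrite /= in_itv/= u0.
by rewrite GE ler_pdivrMr// /H_density subr_ge0.
Qed.
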